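(* Let $K$ be a local field with prime element $\mathfrak p$ and residue field of cardinality $q$. Let $0<r,t\le\infty$ and $s>\sigma_r:=\max\left(\frac1r-1,0\right)$. For $k\in\mathbb N=\{1,2,\dots\}$ let $T_k$ be the dilation operator $(T_kf)(x)=f(\mathfrak p^{-k}x)$, $x\in K$. Then there is a constant $c$, independent of $k$ and $f$, such that for all $k\in\mathbb N$ and all $f\in B^s_{rt}(K)$ $$\|T_kf\|_{B^s_{rt}(K)}\le c\,k^{1/t}\,q^{k(s-\frac1r)}\,\|f\|_{B^s_{rt}(K)}.$$
   Context: A local field $K$ here is a locally compact, non-discrete, totally disconnected topological field, with its natural non-Archimedean absolute value $|\cdot|$, defined by $d(\alpha x)=|\alpha|\,dx$ for a Haar measure $dx$ of the additive group $K^+$. $\mathfrak D=\{x\in K:|x|\le1\}$ is the ring of integers, $\mathfrak P=\{x\in K:|x|<1\}$ its prime ideal, $\mathfrak D/\mathfrak P\cong GF(q)$, and $\mathfrak p\in\mathfrak P$ is a fixed element of maximal absolute value, so $|\mathfrak p|=q^{-1}$. Haar measure is normalized by $|\mathfrak D|=1$. Put $\mathfrak P^k=\mathfrak p^k\mathfrak D=\{x:|x|\le q^{-k}\}$, $k\in\mathbb Z$. Fix a character $\chi$ of $K^+$ that is trivial on $\mathfrak D$ and non-trivial on $\mathfrak P^{-1}$. The dual group $\Gamma$ of $K^+$ is identified with $K$ via $\lambda\leftrightarrow\chi_\lambda$, $\chi_\lambda(x)=\chi(\lambda x)$. $\Gamma^k=\{\xi\in\Gamma:|\xi|\le q^k\}$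 is the annihilator of $\mathfrak P^k$, and the Haar measure of $\Gamma$ is normalized by $|\Gamma^0|=1$. $S(K)$ is the space of test functions: finite complex linear combinations of characteristic functions of translates $h+\mathfrak P^j$ ($h\in K$, $j\in\mathbb Z$). A sequence in $S(K)$ is null if its members are all constant on cosets of one fixed $\mathfrak P^l$, all supported in one fixed $\mathfrak P^m$, and converge to $0$ uniformly. $S'(K)$ is the space of continuous linear functionals (distributions) on $S(K)$, with the weak$^*$ topology; $S(\Gamma)$, $S'(\Gamma)$ are defined likewise. For test functions, $\mathcal F\phi(\xi)=\int_K\phi(x)\overline{\chi_\xi(x)}\,dx$ and $\mathcal F^{-1}\phi(x)=\int_\Gamma\phi(\xi)\chi_x(\xi)\,d\xi$; these extend to distributions by $\langle\mathcal Ff,\phi\rangle=\langle f,\mathcal F\phi\rangle$ and $\langle\mathcal F^{-1}g,\psi\rangle=\langle g,\mathcal F^{-1}\psi\rangle$. Let $\phi_0$ be the characteristic function of $\Gamma^0$ and, for $j\ge1$, $\phi_j$ the characteristic function of $\Gamma^j\setminus\Gamma^{j-1}$. For $f\in S'(K)$ and $j\ge 0$ set $\Delta_jf=\mathcal F^{-1}(\phi_j\,\mathcal Ff)$. For $s\in\mathbb R$ and $0<r,t\le\infty$, the Besov space $B^s_{rt}(K)$ consists of all $f\in S'(K)$ with $$\|f\|_{B^s_{rt}(K)}=\Big(\sum_{j=0}^\infty q^{sjt}\|\Delta_jf\|_{L^r(K)}^t\Big)^{1/t}<\infty,$$ with the usual supremum modification if $t=\infty$ (and essential supremum if $r=\infty$);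 $1/\infty=0$. For a distribution $f$ the dilation is $\langle T_kf,\phi\rangle=q^{-k}\langle f,\phi(\mathfrak p^k\,\cdot)\rangle$, which agrees with $f(\mathfrak p^{-k}x)$ for locally integrable $f$. *)

(* Defs.v *)
From HB Require Import structures.
From mathcomp Require Import all_boot all_order all_algebra complex.
From mathcomp Require Import all_classical all_reals all_analysis.
Set Implicit Arguments.
Unset Strict Implicit.
Unset Printing Implicit Defensive.
Import Order.TTheory GRing.Theory Num.Theory.
Import numFieldNormedType.Exports.
Local Open Scope classical_set_scope.
Local Open Scope ring_scope.
Local Open Scope card_scope.

HB.mixin Record TopologicalZmodule_isTopologicalField K
    & TopologicalZmodule K & GRing.Field K := {
  tfmul_continuous : continuous (fun z : K * K => z.1 * z.2) ;
  tfinv_continuous : forall x : K, x != 0 ->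
    {for x, continuous (GRing.inv : K -> K)}
}.

#[short(type="topologicalFieldType")]
HB.structure Definition TopologicalField :=
  {K of TopologicalZmodule K & GRing.Field K
      & TopologicalZmodule_isTopologicalField K}.

Definition local_field (K : topologicalFieldType) : Prop :=
  [/\ locally_compact [set: K], ~ open [set (0 : K)]
    & totally_disconnected [set: K]].

(* The cast only lets the pointedType that g_sigma_algebraType needs be found. *)
Definition borel (K : topologicalFieldType) :=
  g_sigma_algebraType (@open K : set (set (K : zmodType))).

Section Setting.
Variables (R : realType) (K : topologicalFieldType).
Variable mu : {measure set (borel K) -> \bar R}.

(* No regularity clause: a local field is second countable, so that such a
   measure is automatically regular. *)
Definition haar_measure : Prop :=
  [/\ (forall (a : K) (A : set (borel K)), measurable A ->
         mu [set a + x | x in A] = mu A),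
      (forall A : set K, compact A -> (mu A < +oo)%E)
    & (forall A : set K, open A -> A !=set0 -> (0 < mu A)%E)].

(* d(a x) = |a| dx, which determines abs. For a = 0 it says that points are
   null, as they are in a non-discrete K; recall 0 * +oo = 0. *)
Definition natural_abs (abs : K -> R) : Prop :=
  (forall (a : K) (A : set (borel K)), measurable A ->
     mu [set a * x | x in A] = ((abs a)%:E * mu A)%E) /\
  (forall x y : K, abs (x + y) <= Num.max (abs x) (abs y)).

Variable abs : K -> R.

Definition integers : set K := [set x | abs x <= 1].

Definition prime_ideal : set K := [set x | abs x < 1].

Definition prime_element (p : K) : Prop :=
  prime_ideal p /\ forall x, prime_ideal x -> abs x <= abs p.

Definition residue_card (q : nat) : Prop :=
  [set [set x + y | y in prime_ideal] | x in integers] #= `I_q.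

Variable q : nat.

Definition Pideal (k : int) : set K := [set x | abs x <= q%:R ^ (- k)].

Definition Gammaball (k : int) : set K := [set x | abs x <= q%:R ^ k].

Definition basic_character (chi : K -> R[i]) : Prop :=
  [/\ (forall x y, chi (x + y) = chi x * chi y) /\
        (forall x, Normc.normc (chi x) = 1),
      continuous (chi : K -> (R[i] : numFieldType)),
      (forall x, integers x -> chi x = 1)
    & (exists x, Pideal (- 1) x /\ chi x <> 1)].

Variable chi : K -> R[i].

Definition test_function (phi : K -> R[i]) : Prop :=
  exists n (c : 'I_n -> R[i]) (h : 'I_n -> K) (j : 'I_n -> int),
    forall x, phi x =
      \sum_(i < n) c i * \1_([set h i + y | y in Pideal (j i)]) x.

Definition null_sequence (phi : nat -> K -> R[i]) : Prop :=
  [/\ (forall n, test_function (phi n)),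
      (exists l, forall n x y, Pideal l (x - y) -> phi n x = phi n y),
      (exists m, forall n x, phi n x != 0 -> Pideal m x)
    & (forall e : R, 0 < e ->
         \forall n \near \oo, forall x, Normc.normc (phi n x) < e)].

(* Functionals are total on K -> R[i], but only their values on test functions
   matter: two of them agreeing there are the same distribution. This lets the
   operations below be plain functions. *)
Definition functional := (K -> R[i]) -> R[i].

Definition is_distribution (f : functional) : Prop :=
  (forall (a : R[i]) phi psi, test_function phi -> test_function psi ->
     f (fun x => a * phi x + psi x) = a * f phi + f psi) /\
  (forall phi, null_sequence phi ->
     (fun n => f (phi n) : (R[i] : numFieldType)) @ \oo --> 0).

Definition cintegral (h : K -> R[i]) : R[i] :=
  ((\int[mu]_x complex.Re (h x)) +i* (\int[mu]_x complex.Im (h x)))%C.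

(* Gamma is identified with K through l |-> chi (l * _); the Haar measure of
   Gamma is then mu as well, since Gamma^0 corresponds to integers. *)
Definition fourier (phi : K -> R[i]) : K -> R[i] :=
  fun xi => cintegral (fun x => phi x * (chi (xi * x))^*%C).

Definition fourier_inv (phi : K -> R[i]) : K -> R[i] :=
  fun x => cintegral (fun xi => phi xi * chi (x * xi)).

Definition dfourier (f : functional) : functional := fun phi => f (fourier phi).

Definition dfourier_inv (g : functional) : functional :=
  fun psi => g (fourier_inv psi).

Definition dmul (w : K -> R[i]) (g : functional) : functional :=
  fun psi => g (fun x => w x * psi x).

Definition shell (j : nat) : set K :=
  if j is i.+1 then Gammaball i.+1%:Z `\` Gammaball i%:Z else Gammaball 0.

Definition Delta (j : nat) (f : functional) : functional :=
  dfourier_inv (dmul \1_(shell j) (dfourier f)).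

Definition loc_integrable (h : K -> R[i]) : Prop :=
  [/\ measurable_fun [set: borel K] (fun x : borel K => complex.Re (h x)),
      measurable_fun [set: borel K] (fun x : borel K => complex.Im (h x))
    & forall A : set K, compact A ->
        (\int[mu]_(x in A) (Normc.normc (h x))%:E < +oo)%E].

Definition represents (h : K -> R[i]) (g : functional) : Prop :=
  loc_integrable h /\
  forall phi, test_function phi -> g phi = cintegral (fun x => h x * phi x).

(* L^r (quasi-)norm of a distribution: that of the function representing it,
   which is unique almost everywhere, and +oo if there is none. *)
Definition dLnorm (r : \bar R) (g : functional) : \bar R :=
  ereal_inf [set Lnorm mu r (fun x : borel K => (Normc.normc (h x))%:E)
            | h in [set h | represents h g]].

Definition besov_norm (s : R) (r t : \bar R) (f : functional) : \bar R :=
  match t with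
  | t'%:E => poweR
      (\sum_(0 <= j <oo)
         ((q%:R `^ (s * j%:R * t'))%:E * poweR (dLnorm r (Delta j f)) t'))%E
      t'^-1
  | +oo%E => ereal_sup
      (range (fun j : nat =>
         ((q%:R `^ (s * j%:R))%:E * dLnorm r (Delta j f))%E))
  | -oo%E => 0%E (* unused: t > 0 *)
  end.

Definition besov (s : R) (r t : \bar R) (f : functional) : Prop :=
  is_distribution f /\ (besov_norm s r t f < +oo)%E.

Definition dilation (p : K) (k : nat) (f : functional) : functional :=
  fun phi => (q%:R ^+ k)^-1 * f (fun x => phi (p ^+ k * x)).

End Setting.

(* 1 / r for r in ]0, +oo], with 1 / +oo = 0 *)
Definition rinv (R : realType) (r : \bar R) : R := fine (inve r).

Definition sigma_r (R : realType) (r : \bar R) : R := Num.max (rinv r - 1) 0.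

(* Main.v *)
Require Import Defs.
From mathcomp Require Import all_boot all_order all_algebra complex.
From mathcomp Require Import all_classical all_reals all_analysis.
From mathcomp Require Import measurable_realfun ess_sup_inf zify ring lra.
Import Order.TTheory GRing.Theory Num.Theory.
Import numFieldNormedType.Exports.
Local Open Scope classical_set_scope.
Local Open Scope ring_scope.
Set Implicit Arguments.
Unset Strict Implicit.
Unset Printing Implicit Defensive.

(** Write h for the function representing Delta_0 f. Dilation moves the frequency shells:
    Delta_(j+k) T_k f = T_k Delta_j f for j >= 1, while for i <= k the piece Delta_i T_k f
    is the dilate by p^k of E_(i-k) h - E_(i-1-k) h (of E_(-k) h if i = 0), where E_m
    takes the mean over the cosets of P^m. Since T_k multiplies L^r norms by q^(-k/r), the
    high frequencies cost the factor q^(k(s-1/r)) exactly. For the low ones, a mean over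
    cosets of P^(-n) costs at most C q^(n sigma_r): by Hoelder's inequality if r >= 1, and
    if r < 1 because h = E_0 h almost everywhere is constant on cosets of D, so that the
    l^r-l^1 inequality applies inside a coset of P^(-n). As s > sigma_r, each of
    the k + 1 low terms is at most C q^(k(s-1/r)) ||h||_r, hence the factor k^(1/t).

    Balls are compact because only finitely many disjoint translates of a small
    neighbourhood of 0 fit into D, which has measure 1. *)

(** * Topological fields *)

(** A piece [Delta j f] is only a functional, so every operator is moved onto the test function:
    [Delta j f phi] is [f] applied to a difference of low-pass images of [phi]. On ball indicators a
    low-pass operator is explicit, which leaves orthogonality of characters as the only Fourier
    computation. Dilation by p^k turns the cut-off at q^i into one at q^(i-k). For i <= k this lies
    inside Gamma^0, where Delta_0 acts as the identity; hence the low pieces see nothing of f but h,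
    and averages of h, the adjoints of low-pass operators, represent them.

    The obstacle is r < 1: a mean of h is controlled by an integral of |h|, which the L^r norm alone
    does not bound. The band limit repairs this, because it forbids concentration on sets smaller
    than a coset of measure 1.

    In the i-th low term the exponents of q add up to s i - k/r + (k+1-i) sigma_r. Since s >
    sigma_r, the worst case is i = k.

    Apart from the ultrametric inequality, the absolute value is known only by its effect on Haar
    measure, so multiplicativity, |p| = 1/q and even p != 0 are read off from measures of sets. *)

Section TopologicalFieldTheory.
Variable K : topologicalFieldType.
Implicit Types (a x y : K) (A B C : set K).

Lemma continuous_translation a : continuous (fun x : K => a + x).
Proof.
move=> x; apply: (@continuous2_cvg K K K K (nbhs x) _ (cst a) id (fun y z => y + z)).
- exact: (@add_continuous K (a, x)).
- exact: cvg_cst.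
- exact: cvg_id.
Qed.

Lemma continuous_scaling a : continuous (fun x : K => a * x).
Proof.
move=> x; apply: (@continuous2_cvg K K K K (nbhs x) _ (cst a) id (fun y z => y * z)).
- exact: (@tfmul_continuous K (a, x)).
- exact: cvg_cst.
- exact: cvg_id.
Qed.

Lemma translationE a A : [set a + x | x in A] = (fun x => - a + x) @^-1` A.
Proof.
apply/seteqP; split=> [_ [x Ax <-]|x Ax] /=; first by rewrite addKr.
by exists (- a + x) => //; rewrite addNKr.
Qed.

Lemma scalingE a A : a != 0 ->
  [set a * x | x in A] = (fun x => a^-1 * x) @^-1` A.
Proof.
move=> a0; apply/seteqP; split=> [_ [x Ax <-]|x Ax] /=; first by rewrite mulKf.
by exists (a^-1 * x) => //; rewrite mulVKf.
Qed.

Lemma open_translation a A : open A -> open [set a + x | x in A].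
Proof.
by move=> oA; rewrite translationE; apply: open_comp => // x _;
  exact: continuous_translation.
Qed.

Lemma open_scaling a A : a != 0 -> open A -> open [set a * x | x in A].
Proof.
by move=> a0 oA; rewrite scalingE//; apply: open_comp => // x _;
  exact: continuous_scaling.
Qed.

Lemma measurable_borel_open A : open A -> measurable (A : set (borel K)).
Proof. exact: sub_sigma_algebra. Qed.

Lemma continuous_borel_measurable (f : K -> K) : continuous f ->
  measurable_fun [set: borel K] (f : borel K -> borel K).
Proof.
move=> cf.
apply: (@measurability _ _ (borel K) (borel K) setT f (@open K : set (set (borel K)))) => //.
move=> _ [A oA <-]; rewrite setTI; apply: measurable_borel_open.
by apply: open_comp => // x _; exact: cf.
Qed.

Lemma measurable_translation a A : measurable (A : set (borel K)) ->
  measurable ([set a + x | x in A] : set (borel K)).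
Proof.
move=> mA; rewrite translationE -[X in measurable X]setTI.
by apply: (continuous_borel_measurable (@continuous_translation _)).
Qed.

Lemma measurable_scaling a A : a != 0 -> measurable (A : set (borel K)) ->
  measurable ([set a * x | x in A] : set (borel K)).
Proof.
move=> a0 mA; rewrite scalingE// -[X in measurable X]setTI.
by apply: (continuous_borel_measurable (@continuous_scaling _)).
Qed.

Lemma compact_translation a A : compact A -> compact [set a + x | x in A].
Proof.
by apply: continuous_compact; apply: continuous_subspaceT;
  exact: continuous_translation.
Qed.

Hypothesis hK : local_field K.

(** The closure of {0} is connected, hence lies in the component of 0, which is {0} by total
    disconnectedness. So {0} is closed, and continuity of subtraction separates x from y because x -
    y avoids it. This makes compact sets Borel. *)
Lemma local_field_hausdorff : hausdorff_space K.
Proof.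
case: hK => _ _ td.
have c0 : closed [set (0 : K)].
  suff -> : [set (0 : K)] = closure [set 0] by exact: closed_closure.
  apply/seteqP; split; first exact: subset_closure.
  rewrite -[X in _ `<=` X](td 0 I); apply: connected_component_max => //.
    exact: subset_closure.
  by apply: connected_closure; exact: connected1.
move=> x y xy; apply: contrapT => /eqP nxy.
have : nbhs (x - y) (~` [set (0 : K)]).
  apply: open_nbhs_nbhs; split; first exact: closed_openC.
  by move=> /= /eqP; rewrite subr_eq0; exact/negP.
move=> /(@sub_continuous K (x, y))[[A B] /= [Ax By] AB].
have [z [Az Bz]] := xy _ _ Ax By.
by have /= := AB (z, z) (conj Az Bz); rewrite subrr; apply.
Qed.

Lemma compact_nbhs0 : exists U C : set K, [/\ open U, U 0, U `<=` C & compact C].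
Proof.
case: hK => /(_ 0 I) [C + [cC _]] _ _.
rewrite withinET nbhsE => -[U [oU U0] UC].
by exists U, C.
Qed.

End TopologicalFieldTheory.

(** * Complex-valued integrals *)

Section ComplexIntegral.
Variables (R : realType) (K : topologicalFieldType).
Variable mu : {measure set (borel K) -> \bar R}.
Implicit Types (f g h : K -> R[i]) (z : R[i]).
Local Notation Re := complex.Re.
Local Notation Im := complex.Im.
Local Notation normc := Normc.normc.

Lemma complexReD z1 z2 : Re (z1 + z2) = Re z1 + Re z2 :> R.
Proof. by case: z1 z2 => ? ? []. Qed.

Lemma complexImD z1 z2 : Im (z1 + z2) = Im z1 + Im z2 :> R.
Proof. by case: z1 z2 => ? ? []. Qed.

Lemma complexReM z1 z2 : Re (z1 * z2) = Re z1 * Re z2 - Im z1 * Im z2 :> R.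
Proof. by case: z1 z2 => ? ? []. Qed.

Lemma complexImM z1 z2 : Im (z1 * z2) = Re z1 * Im z2 + Im z1 * Re z2 :> R.
Proof. by case: z1 z2 => ? ? []. Qed.

Lemma normc_sqrtE z : normc z = Num.sqrt (Re z ^+ 2 + Im z ^+ 2).
Proof. by case: z. Qed.

Lemma normc_ge0 z : 0 <= normc z.
Proof. by rewrite normc_sqrtE sqrtr_ge0. Qed.

Lemma normRe_le z : `|Re z| <= normc z.
Proof. by rewrite normc_sqrtE -sqrtr_sqr ler_wsqrtr// lerDl sqr_ge0. Qed.

Lemma normIm_le z : `|Im z| <= normc z.
Proof. by rewrite normc_sqrtE -sqrtr_sqr ler_wsqrtr// lerDr sqr_ge0. Qed.

Lemma normc_le_sum z : normc z <= `|Re z| + `|Im z|.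
Proof.
rewrite normc_sqrtE -(ger0_norm (addr_ge0 (normr_ge0 (Re z)) (normr_ge0 (Im z)))).
rewrite -sqrtr_sqr ler_wsqrtr// sqrrD !real_normK ?num_real//.
by rewrite addrAC lerDl mulrn_wge0// mulr_ge0.
Qed.

Definition cmeasurable h :=
  measurable_fun [set: borel K] (fun x : borel K => Re (h x)) /\
  measurable_fun [set: borel K] (fun x : borel K => Im (h x)).

Definition cintegrable h :=
  mu.-integrable [set: borel K] (fun x : borel K => (Re (h x))%:E) /\
  mu.-integrable [set: borel K] (fun x : borel K => (Im (h x))%:E).

Lemma cintegrable_measurable h : cintegrable h -> cmeasurable h.
Proof.
by move=> [/integrableP[+ _] /integrableP[+ _]] => /measurable_EFinP ? /measurable_EFinP.
Qed.

Lemma cmeasurableD f g : cmeasurable f -> cmeasurable g -> cmeasurable (fun x => f x + g x).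
Proof.
move=> [rf jf] [rg jg]; split.
  by under eq_fun do rewrite complexReD; exact: measurable_funD.
by under eq_fun do rewrite complexImD; exact: measurable_funD.
Qed.

Lemma cmeasurableM f g : cmeasurable f -> cmeasurable g -> cmeasurable (fun x => f x * g x).
Proof.
move=> [rf jf] [rg jg]; split.
  under eq_fun do rewrite complexReM.
  by apply: measurable_funB; exact: measurable_funM.
under eq_fun do rewrite complexImM.
by apply: measurable_funD; exact: measurable_funM.
Qed.

Lemma cmeasurable_cst z : cmeasurable (fun=> z).
Proof. by split; exact: measurable_cst. Qed.

Lemma cmeasurable_indic (A : set K) : measurable (A : set (borel K)) ->
  cmeasurable (\1_A : K -> R[i]).
Proof.
move=> mA; split.
- rewrite (_ : (fun x => _) = (\1_A : borel K -> R)); first exact: measurable_indic.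
  by apply/funext => x; rewrite !indicE; case: (x \in A).
- rewrite (_ : (fun x => _) = cst 0); first exact: measurable_cst.
  by apply/funext => x; rewrite !indicE; case: (x \in A).
Qed.

Lemma measurable_normc h : cmeasurable h ->
  measurable_fun [set: borel K] (fun x : borel K => normc (h x)).
Proof.
move=> [rh ih]; under eq_fun do rewrite normc_sqrtE.
apply: (measurableT_comp (continuous_measurable_fun (@sqrt_continuous R))).
by apply: measurable_funD; exact: measurable_funX.
Qed.

Lemma cintegrable_normc h : cintegrable h <->
  cmeasurable h /\ (\int[mu]_x (normc (h x))%:E < +oo)%E.
Proof.
split=> [ih|[mh fh]].
  have mh := cintegrable_measurable ih.
  split=> //; case: ih => /integrable_abse ir /integrable_abse ii.
  have /integrableP[_] := integrableD measurableT ir ii.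
  apply: le_lt_trans; apply: ge0_le_integral => //=.
  - by move=> x _; rewrite lee_fin normc_ge0.
  - by apply/measurable_EFinP; exact: measurable_normc.
  - apply/measurable_EFinP; apply: measurableT_comp => //; case: mh => rh jh.
    by apply: measurable_funD; exact: measurableT_comp.
  - by move=> x _; rewrite lee_fin ger0_norm ?addr_ge0// normc_le_sum.
have inorm : mu.-integrable [set: borel K] (fun x : borel K => (normc (h x))%:E).
  apply/integrableP; split; first by apply/measurable_EFinP; exact: measurable_normc.
  by under eq_integral do rewrite gee0_abs ?lee_fin ?normc_ge0//.
case: mh => rh jh; split; apply: le_integrable inorm => //.
- exact/measurable_EFinP.
- by move=> x _; rewrite lee_fin [leRHS]ger0_norm ?normc_ge0// normRe_le.
- exact/measurable_EFinP.
- by move=> x _; rewrite lee_fin [leRHS]ger0_norm ?normc_ge0// normIm_le.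
Qed.

Lemma integrable_lin (a b : R) (u v : borel K -> R) :
  mu.-integrable setT (EFin \o u) -> mu.-integrable setT (EFin \o v) ->
  mu.-integrable setT (EFin \o (fun x => a * u x + b * v x)).
Proof.
move=> iu iv.
exact: (integrableD measurableT (integrableZl measurableT a iu) (integrableZl measurableT b iv)).
Qed.

Lemma Rintegral_lin (a b : R) (u v : borel K -> R) :
  mu.-integrable setT (EFin \o u) -> mu.-integrable setT (EFin \o v) ->
  \int[mu]_x (a * u x + b * v x) = a * \int[mu]_x u x + b * \int[mu]_x v x.
Proof.
move=> iu iv; rewrite -!RintegralZl// RintegralD//.
- exact: (integrableZl measurableT a iu).
- exact: (integrableZl measurableT b iv).
Qed.

Lemma cintegrable_lin z f g : cintegrable f -> cintegrable g ->
  cintegrable (fun x => z * f x + g x).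
Proof.
move=> [rf jf] [rg jg]; split.
- rewrite (_ : (fun x => _) = EFin \o
      (fun x => 1 * (Re z * Re (f x) + (- Im z) * Im (f x)) + 1 * Re (g x))).
    by apply: integrable_lin => //; exact: integrable_lin.
  by apply/funext => x /=; rewrite complexReD complexReM !mul1r mulNr.
- rewrite (_ : (fun x => _) = EFin \o
      (fun x => 1 * (Re z * Im (f x) + Im z * Re (f x)) + 1 * Im (g x))).
    by apply: integrable_lin => //; exact: integrable_lin.
  by apply/funext => x /=; rewrite complexImD complexImM !mul1r.
Qed.

Lemma cintegral_lin z f g : cintegrable f -> cintegrable g ->
  cintegral mu (fun x => z * f x + g x) = z * cintegral mu f + cintegral mu g.
Proof.
move=> [rf jf] [rg jg]; rewrite /cintegral.
have -> : \int[mu]_x Re (z * f x + g x) =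
    1 * \int[mu]_x (Re z * Re (f x) + (- Im z) * Im (f x)) + 1 * \int[mu]_x Re (g x).
  rewrite -Rintegral_lin//; last exact: integrable_lin.
  by apply: eq_Rintegral => x _; rewrite complexReD complexReM !mul1r mulNr.
have -> : \int[mu]_x Im (z * f x + g x) =
    1 * \int[mu]_x (Re z * Im (f x) + Im z * Re (f x)) + 1 * \int[mu]_x Im (g x).
  rewrite -Rintegral_lin//; last exact: integrable_lin.
  by apply: eq_Rintegral => x _; rewrite complexImD complexImM !mul1r.
rewrite !Rintegral_lin// !mul1r mulNr.
by case: z => a b; apply/eqP; rewrite eq_complex /= !eqxx.
Qed.

Lemma cintegrable0 : cintegrable (fun=> 0).
Proof. by split; exact: integrable0. Qed.

Lemma cintegral0 : cintegral mu (fun=> 0) = 0.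
Proof. by rewrite /cintegral /Rintegral /= integral0. Qed.

Lemma cintegrableZ z f : cintegrable f -> cintegrable (fun x => z * f x).
Proof.
move=> fi; have := cintegrable_lin z fi cintegrable0.
by under eq_fun do rewrite addr0.
Qed.

Lemma cintegralZ z f : cintegrable f ->
  cintegral mu (fun x => z * f x) = z * cintegral mu f.
Proof.
move=> fi; have := cintegral_lin z fi cintegrable0; rewrite cintegral0 addr0 => <-.
by congr cintegral; apply/funext => x; rewrite addr0.
Qed.

Lemma cintegrable_le f g : cmeasurable f -> cintegrable g ->
  (forall x, normc (f x) <= normc (g x)) -> cintegrable f.
Proof.
move=> mf /cintegrable_normc[mg gi] fg; apply/cintegrable_normc; split=> //.
apply: le_lt_trans gi; apply: ge0_le_integral => //.
- by move=> x _; rewrite lee_fin normc_ge0.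
- by apply/measurable_EFinP; exact: measurable_normc.
- by apply/measurable_EFinP; exact: measurable_normc.
- by move=> x _; rewrite lee_fin.
Qed.

Lemma cintegrableM_bounded f g (M : R) : cintegrable f -> cmeasurable g ->
  (forall x, normc (g x) <= M) -> cintegrable (fun x => f x * g x).
Proof.
move=> fi mg gM; have mf := cintegrable_measurable fi.
apply: (@cintegrable_le _ (fun x => M%:C%C * f x)); last 2 first.
- exact: cintegrableZ.
- move=> x; rewrite !Normc.normcM mulrC ler_wpM2r ?normc_ge0//.
  apply: le_trans (gM x) _; rewrite normc_sqrtE/= expr0n/= addr0 sqrtr_sqr.
  exact: ler_norm.
- exact: cmeasurableM.
Qed.

(** The factor 2 comes from bounding the real and the imaginary part separately by the integral of
    the modulus; it only enlarges the final constant. *)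
Lemma normc_cintegral_le h : cintegrable h ->
  ((normc (cintegral mu h))%:E <= 2%:E * \int[mu]_x (normc (h x))%:E)%E.
Proof.
move=> ih; have [mh _] := (cintegrable_normc h).1 ih; case: ih => rh jh.
apply: (@le_trans _ _ (`|\int[mu]_x Re (h x)| + `|\int[mu]_x Im (h x)|)%:E).
  by rewrite lee_fin; exact: normc_le_sum.
rewrite mule_natl mule2n EFinD.
rewrite !EFin_normr_Rintegral//; apply: leeD.
  apply: le_trans (le_abse_integral _ _ _) _ => //; first by case/integrableP: rh.
  apply: ge0_le_integral => //.
  - by apply: measurableT_comp => //; case/integrableP: rh.
  - by apply/measurable_EFinP; exact: measurable_normc.
  - by move=> x _; rewrite lee_fin normRe_le.
apply: le_trans (le_abse_integral _ _ _) _ => //; first by case/integrableP: jh.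
apply: ge0_le_integral => //.
- by apply: measurableT_comp => //; case/integrableP: jh.
- by apply/measurable_EFinP; exact: measurable_normc.
- by move=> x _; rewrite lee_fin normIm_le.
Qed.

Lemma ReM_indic h A x : Re (h x * \1_A x) = ((fun x => Re (h x)) \_ A) x.
Proof. by rewrite indicE patchE; case: ifP => _; rewrite ?mulr1 ?mulr0. Qed.

Lemma ImM_indic h A x : Im (h x * \1_A x) = ((fun x => Im (h x)) \_ A) x.
Proof. by rewrite indicE patchE; case: ifP => _; rewrite ?mulr1 ?mulr0. Qed.

Lemma normcM_indic h A x : normc (h x * \1_A x) = ((fun x => normc (h x)) \_ A) x.
Proof.
by rewrite indicE patchE; case: ifP => _; rewrite ?mulr1 ?mulr0 ?Normc.normc0.
Qed.

Lemma integral_normcM_indic h A :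
  (\int[mu]_x (normc (h x * \1_A x))%:E = \int[mu]_(x in A) (normc (h x))%:E)%E.
Proof.
rewrite [RHS]integral_mkcond; apply: eq_integral => x _.
by rewrite normcM_indic !patchE; case: ifP.
Qed.

Lemma loc_integrable_indic h A : loc_integrable mu h -> compact A ->
  measurable (A : set (borel K)) -> cintegrable (fun x => h x * \1_A x).
Proof.
move=> [rh jh hA] cA mA; apply/cintegrable_normc; split.
  by apply: cmeasurableM; [split|exact: cmeasurable_indic].
by rewrite integral_normcM_indic; exact: hA.
Qed.

Lemma cintegral_indic A : measurable (A : set (borel K)) ->
  cintegral mu (\1_A : K -> R[i]) = (fine (mu A))%:C%C.
Proof.
move=> mA; have e : (\int[mu]_x (\1_A x : R)%:E = mu A)%E by rewrite integral_indic// setIT.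
rewrite /cintegral /Rintegral; congr (_ +i* _)%C.
  rewrite -e; congr fine; apply: eq_integral => x _.
  by rewrite !indicE; case: (x \in A).
rewrite -[RHS]/(fine 0%E) -[in RHS](@integral0 _ (borel K) R mu setT); congr fine.
by apply: eq_integral => x _; rewrite !indicE; case: (x \in A).
Qed.

Lemma cintegrable_indic A : measurable (A : set (borel K)) -> (mu A < +oo)%E ->
  cintegrable (\1_A : K -> R[i]).
Proof.
move=> mA Af; apply/cintegrable_normc; split; first exact: cmeasurable_indic.
rewrite (_ : \int[mu]_x _ = mu A)%E//.
have e : (\int[mu]_x (\1_A x : R)%:E = mu A)%E by rewrite integral_indic// setIT.
rewrite -e.
by apply: eq_integral => x _; rewrite !indicE; case: (x \in A);
  rewrite ?Normc.normc1 ?Normc.normc0.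
Qed.

End ComplexIntegral.

(** * Test functions and induction over ball indicators *)

Definition cball (R : realType) (K : topologicalFieldType) (abs : K -> R) (q : nat)
  (k : int) (a : K) : set K := [set a + y | y in Pideal abs q k].

Section TestFunctions.
Variables (R : realType) (K : topologicalFieldType) (abs : K -> R) (q : nat).
Implicit Types (f g phi psi : K -> R[i]) (z : R[i]).
Local Notation test := (test_function abs q).

Lemma test_function0 : test (fun=> 0).
Proof.
exists 0, (fun=> 0), (fun=> 0), (fun=> 0) => x.
by rewrite big_ord0.
Qed.

Lemma test_function_cons z k a g : test g ->
  test (fun x => z * \1_(cball abs q k a) x + g x).
Proof.
move=> [n [c [h [j gE]]]].
exists n.+1, (fun i => oapp c z (unlift ord0 i)), (fun i => oapp h a (unlift ord0 i)),
  (fun i => oapp j k (unlift ord0 i)) => x.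
rewrite big_ord_recl unlift_none /= gE; congr (_ + _).
by apply: eq_bigr => i _; rewrite liftK.
Qed.

Lemma test_function_cons_ind (P : (K -> R[i]) -> Prop) : P (fun=> 0) ->
  (forall z k a g, test g -> P g -> P (fun x => z * \1_(cball abs q k a) x + g x)) ->
  forall phi, test phi -> P phi.
Proof.
move=> P0 Pc phi [n [c [h [j /funext ->]]]].
suff [] : test (fun x => \sum_(i < n) c i * \1_(cball abs q (j i) (h i)) x) /\
    P (fun x => \sum_(i < n) c i * \1_(cball abs q (j i) (h i)) x) by [].
elim: n c h j => [|n ih] c h j.
  by under eq_fun do rewrite big_ord0; split=> //; exact: test_function0.
under eq_fun do rewrite big_ord_recl.
have [tn Pn] := ih (fun i => c (lift ord0 i)) (fun i => h (lift ord0 i)) (fun i => j (lift ord0 i)).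
by split; [exact: test_function_cons|exact: Pc].
Qed.

Lemma test_function_lin z f g : test f -> test g -> test (fun x => z * f x + g x).
Proof.
move=> tf tg; elim/test_function_cons_ind : f / tf => [|y k a f tf tfg].
  by under eq_fun do rewrite mulr0 add0r.
under eq_fun do rewrite mulrDr mulrA -addrA.
exact: test_function_cons.
Qed.

Lemma test_function_cball k a : test (\1_(cball abs q k a)).
Proof.
have := test_function_cons 1 k a test_function0.
by under eq_fun do rewrite mul1r addr0.
Qed.

(** The principle behind the identities for test functions below: ball indicators carry the
    computation, linearity does the rest. *)
Lemma test_function_ind (P : (K -> R[i]) -> Prop) : P (fun=> 0) ->
  (forall k a, P \1_(cball abs q k a)) ->
  (forall z f g, test f -> test g -> P f -> P g -> P (fun x => z * f x + g x)) ->
  forall phi, test phi -> P phi.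
Proof.
move=> P0 Pb Pl; apply: test_function_cons_ind => // z k a g tg Pg.
by apply: Pl => //; exact: test_function_cball.
Qed.

End TestFunctions.

(** * Power means *)

Section PowerMeans.
Context d (T : measurableType d) (R : realType) (m : {measure set T -> \bar R}).
Implicit Types (u w : T -> R) (B : set T).
Local Open Scope ereal_scope.

Lemma poweR_le (x y : \bar R) (r : R) : (0 <= r)%R -> 0 <= x -> x <= y -> x `^ r <= y `^ r.
Proof.
move=> r0 x0 xy; apply: gt0_ler_poweR => //; rewrite in_itv/= leey andbT//.
exact: le_trans xy.
Qed.

(** Hoelder's inequality for u times the indicator of B against that indicator, with exponents r and
    r / (r - 1); the norm of the second factor, raised to the power r, is V^(r-1). For r = 1 the
    conjugate exponent is infinite, so that case is direct. *)
Lemma hoelder_set u B (V r : R) : measurable_fun setT u -> (forall x, 0 <= u x)%R ->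
  measurable B -> m B = V%:E -> (0 < V)%R -> (1 <= r)%R ->
  (\int[m]_(x in B) (u x)%:E) `^ r <= (V `^ (r - 1))%:E * \int[m]_(x in B) (u x `^ r)%:E.
Proof.
move=> mu u0 mB BV V0; rewrite le_eqVlt => /predU1P[<-|r1].
  rewrite subrr powRr0 mul1e poweRe1; last by apply: integral_ge0 => x _; rewrite lee_fin.
  rewrite le_eqVlt; apply/orP; left; apply/eqP; apply: eq_integral => x _.
  by rewrite powRr1.
have r0 : (0 < r)%R by exact: lt_trans r1.
pose s : R := (r / (r - 1))%R.
have s0 : (0 < s)%R by rewrite divr_gt0// subr_gt0.
have rs : (r^-1 + s^-1 = 1)%R.
  by rewrite invf_div -{1}(mul1r r^-1%R) -mulrDl addrC subrK divff// lt0r_neq0.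
have m1 : measurable_fun setT (\1_B : T -> R) by exact: measurable_indic.
have := hoelder m (measurable_funM mu m1) m1 r0 s0 rs.
rewrite Lnorm1.
have -> : \int[m]_x `|(EFin \o ((u \* \1_B) \* \1_B)%R) x| = \int[m]_(x in B) (u x)%:E.
  rewrite [RHS]integral_mkcond; apply: eq_integral => x _.
  rewrite /= patchE indicE; case: ifP => _; rewrite ?mulr1 ?mulr0 ?normr0//.
  by rewrite ger0_norm.
move=> h; have /(poweR_le (ltW r0)) := h.
rewrite integral_ge0; last by move=> x _; rewrite lee_fin.
move=> /(_ isT) /le_trans; apply.
rewrite poweRM ?Lnorm_ge0// poweR_Lnorm ?lt0r_neq0// muleC.
have -> : 'N[m]_s%:E[EFin \o \1_B] `^ r = (V `^ (r - 1))%:E.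
  rewrite unlock /Lnorm.
  have -> : \int[m]_x (`|(EFin \o (\1_B : T -> R)) x| `^ s) = V%:E.
    rewrite -BV -[in RHS](setIT B) -integral_indic//; apply: eq_integral => x _.
    rewrite /= indicE; case: (x \in B); rewrite ?normr1 ?normr0 ?powR1 ?powR0//.
    exact: lt0r_neq0.
  rewrite -poweRrM poweR_EFin; congr (_ `^ _)%:E.
  by rewrite /s invf_div mulrAC -mulrA divff ?mulr1// lt0r_neq0.
rewrite lee_pmul2l//; last by rewrite lte_fin powR_gt0.
rewrite le_eqVlt; apply/orP; left; apply/eqP.
rewrite [RHS]integral_mkcond; apply: eq_integral => x _.
rewrite /= patchE indicE; case: ifP => _; rewrite ?mulr1 ?mulr0 ?normr0 ?powR0 ?lt0r_neq0//.
by rewrite ger0_norm.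
Qed.

(* The pointwise bound [w x `^ r <= \int_B w `^ r] holds when [w] is constant on the
   cells, of measure at least 1, of a partition of [B]. *)
Lemma subadditive_power_mean w B (r : R) : measurable_fun setT w -> (forall x, 0 <= w x)%R ->
  measurable B -> (0 < r)%R -> (r < 1)%R ->
  (forall x, B x -> (w x `^ r)%:E <= \int[m]_(y in B) (w y `^ r)%:E) ->
  (\int[m]_(x in B) (w x)%:E) `^ r <= \int[m]_(x in B) (w x `^ r)%:E.
Proof.
move=> mw w0 mB r0 r1 wB.
have J0 : 0 <= \int[m]_(x in B) (w x `^ r)%:E.
  by apply: integral_ge0 => x _; rewrite lee_fin powR_ge0.
case E : (\int[m]_(x in B) (w x `^ r)%:E) J0 => [j||//]; last by move=> _; rewrite leey.
rewrite lee_fin => j0.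
(* With j the integral of w^r, the hypothesis reads w x <= j^(1/r). Applying this to the first
   factor of w = w^(1-r) w^r and integrating bounds the integral of w by j^((1-r)/r) j = j^(1/r). *)
have wj x : B x -> (w x <= j `^ ((1 - r) / r) * w x `^ r)%R.
  move=> Bx; have := wB _ Bx; rewrite E lee_fin => h.
  have [->|wx0] := eqVneq (w x) 0%R; first by rewrite powR0 ?lt0r_neq0// mulr0.
  have {1}-> : (w x = w x `^ (1 - r) * w x `^ r)%R.
    by rewrite -powRD ?subrK ?powRr1//; apply/implyP.
  rewrite ler_wpM2r ?powR_ge0//.
  rewrite mulrC powRrM (_ : w x `^ (1 - r) = (w x `^ r) `^ r^-1 `^ (1 - r))%R; last first.
    by rewrite -(powRrM _ r) divff ?powRr1// lt0r_neq0.
  apply: ge0_ler_powR; rewrite ?nnegrE ?powR_ge0 ?subr_ge0 ?(ltW r1)//.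
  by apply: ge0_ler_powR; rewrite ?nnegrE ?powR_ge0 ?invr_ge0 ?(ltW r0).
have mwr : measurable_fun setT (fun x => w x `^ r)%R.
  exact: (measurableT_comp (@measurable_powR R r) mw).
have le1 : \int[m]_(x in B) (w x)%:E <= (j `^ ((1 - r) / r))%:E * j%:E.
  rewrite -E -ge0_integralZl//.
  - apply: ge0_le_integral => //.
    + by move=> x _; rewrite lee_fin.
    + by apply/measurable_EFinP; exact: measurable_funTS.
    + apply/measurable_EFinP; apply: measurable_funTS; exact: measurable_funM.
  - by apply/measurable_EFinP; exact: measurable_funTS.
  - by move=> x _; rewrite lee_fin powR_ge0.
  - by rewrite lee_fin powR_ge0.
apply: le_trans (poweR_le (ltW r0) _ le1) _.
  by apply: integral_ge0 => x _; rewrite lee_fin.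
rewrite -EFinM poweR_EFin lee_fin powRM ?powR_ge0// -powRrM divfK ?lt0r_neq0//.
have [->|j1] := eqVneq j 0%R.
  by rewrite (powR0 (lt0r_neq0 r0)) mulr0.
by rewrite -powRD ?subrK ?powRr1//; apply/implyP.
Qed.

End PowerMeans.

Section DelayedSeries.
Variable R : realType.
Implicit Types (u v : nat -> \bar R).
Local Open Scope ereal_scope.

(** Because subtraction is truncated, u 0 occurs for each i <= k, that is k + 1 times, and each
    later term once. This is the origin of the factor k^(1/t). *)
Lemma nneseries_delay_le u (k : nat) : (forall i, 0 <= u i) ->
  \sum_(0 <= i <oo) u (i - k)%N <= k.+1%:R%:E * \sum_(0 <= i <oo) u i.
Proof.
move=> u0; rewrite (nneseries_split 0 k); last by [].
have S0 : 0 <= \sum_(0 <= i <oo) u i by apply: nneseries_ge0.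
rewrite add0n -nneseries_addn//.
have -> : \sum_(0 <= i <oo) u (i + k - k)%N = \sum_(0 <= i <oo) u i.
  by apply: eq_eseriesr => i _; rewrite addnK.
rewrite -natr1 EFinD ge0_muleDl ?lee_fin// mul1e leeD2r//.
have -> : (\sum_(0 <= i < k) u (i - k)%N = \sum_(0 <= i < k) u 0%N)%R.
  by apply: eq_big_nat => i /andP[_ /ltnW]; rewrite -subn_eq0 => /eqP ->.
have u0S : u 0%N <= \sum_(0 <= i <oo) u i.
  by rewrite (nneseries_split 0 1)// big_nat1 leeDl//; exact: nneseries_ge0.
elim: k => [|k ih]; first by rewrite big_geq// mul0e.
rewrite big_nat_recr//= -natr1 EFinD ge0_muleDl ?lee_fin// mul1e.
exact: leeD.
Qed.

End DelayedSeries.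

(** * The absolute value and its balls *)

Section LocalField.
Variables (R : realType) (K : topologicalFieldType).
Variables (mu : {measure set (borel K) -> \bar R}) (abs : K -> R).
Variables (q : nat) (p : K).
Hypothesis hK : local_field K.
Hypothesis hmu : haar_measure mu.
Hypothesis habs : natural_abs mu abs.
Hypothesis hnormalized : mu (integers abs) = 1%E.
Hypothesis hq : residue_card abs q.
Hypothesis hp : prime_element abs p.
Variable chi : K -> R[i].
Hypothesis hchi : basic_character abs q chi.
Implicit Types (a b x y : K) (A B : set K) (j k l : int).
Implicit Types (f g h phi psi : K -> R[i]) (z : R[i]).

Local Notation Pid := (Pideal abs q).
Local Notation cb := (cball abs q).
Local Notation test := (test_function abs q).
Local Notation cintegrable := (cintegrable mu).
Local Notation cintegral := (cintegral mu).
Local Notation normc := Normc.normc.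
Local Notation dilation := (dilation q p).
Local Notation Delta := (Delta mu abs q chi).
Local Notation represents := (represents mu abs q).
Local Notation Q n := (q%:R ^+ n : R).
Local Notation Ln r f := (Lnorm mu r (fun x : borel K => (normc (f x))%:E)).

Lemma measurable_borel_closed A : closed A -> measurable (A : set (borel K)).
Proof.
move=> cA; rewrite -[A]setCK; apply: measurableC.
by apply: measurable_borel_open; exact: closed_openC.
Qed.

Lemma measurable_borel_compact A : compact A -> measurable (A : set (borel K)).
Proof.
by move=> cA; apply: measurable_borel_closed; apply: compact_closed cA;
  exact: local_field_hausdorff.
Qed.

Lemma haar_translation a A : measurable (A : set (borel K)) ->
  mu [set a + x | x in A] = mu A.
Proof. by case: hmu => h _ _; exact: h. Qed.

Lemma haar_scaling a A : measurable (A : set (borel K)) ->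
  mu [set a * x | x in A] = ((abs a)%:E * mu A)%E.
Proof. by case: habs => h _; exact: h. Qed.

(** Such a set is the yardstick for [abs]: as 0 < mu U < +oo, the factor mu U cancels in mu (a U) =
    |a| mu U, which turns claims about [abs] into claims about measures. *)
Lemma open_finite_measure :
  exists2 U : set K, open U /\ U 0 & exists2 m : R, 0 < m & mu U = m%:E.
Proof.
have [U [C [oU U0 UC cC]]] := compact_nbhs0 hK.
case: hmu => _ /(_ _ cC) muC /(_ U oU (ex_intro _ _ U0)) muU.
exists U => //; exists (fine (mu U)).
  rewrite fine_gt0// muU/=; apply: le_lt_trans muC; apply: le_measure => //=;
    rewrite inE; [exact: measurable_borel_open|exact: measurable_borel_compact].
rewrite fineK// ge0_fin_numE//; apply: le_lt_trans muC; apply: le_measure => //=;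
    rewrite inE; [exact: measurable_borel_open|exact: measurable_borel_compact].
Qed.

(** Scaling by 0 sends both {0} and {0, 1} to {0}. With c the finite measure of a point, this gives
    c = |0| c = |0| (c + c), hence c = 0. *)
Lemma haar_set1 x : mu [set x] = 0%E.
Proof.
have m1 y : measurable ([set y] : set (borel K)).
  by apply: measurable_borel_compact; exact: compact_set1.
have -> : mu [set x] = mu [set (0 : K)].
  by rewrite -(haar_translation x (m1 0)) image_set1 addr0.
have mu1 : mu [set (1 : K)] = mu [set (0 : K)].
  by rewrite -(haar_translation 1 (m1 0)) image_set1 addr0.
have fin0 : mu [set (0 : K)] \is a fin_num.
  rewrite ge0_fin_numE//; case: hmu => _ h _; by apply: h; exact: compact_set1.
have e1 : mu [set (0 : K)] = ((abs 0%R)%:E * mu [set (0%R : K)])%E.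
  by have := haar_scaling 0 (m1 0); rewrite image_set1 mulr0.
have e2 : mu [set (0 : K)] = ((abs 0%R)%:E * (mu [set (0%R : K)] + mu [set (0%R : K)]))%E.
  have := haar_scaling 0 (measurableU _ _ (m1 0) (m1 1)).
  rewrite image_setU !image_set1 !mul0r setUid measureU//; last first.
    by apply/seteqP; split=> // y /= [-> /esym/eqP]; rewrite oner_eq0.
  by move=> /= {1}->; rewrite [X in (_ + X)%E]mu1.
move: e2; rewrite {1}e1 -(fineK fin0) -EFinD -!EFinM => -[] /eqP.
rewrite mulrDr -subr_eq0 opprD addNKr oppr_eq0 => /eqP h.
by rewrite e1 -(fineK fin0) -EFinM h.
Qed.

Lemma abs_ge0 a : 0 <= abs a.
Proof.
have [U [oU U0] [m m0 muU]] := open_finite_measure.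
have : (0 <= mu [set (a * x)%R | x in U])%E by exact: measure_ge0.
by rewrite haar_scaling ?muU ?lee_fin ?pmulr_lge0//; exact: measurable_borel_open.
Qed.
#[local] Hint Resolve abs_ge0 : core.

Lemma abs0 : abs 0 = 0.
Proof.
have [U [oU U0] [m m0 muU]] := open_finite_measure.
have := haar_scaling 0 (measurable_borel_open oU).
rewrite (_ : [set _ | _ in _] = [set 0]) ?haar_set1 ?muU; last first.
  apply/seteqP; split => [_ [y _ <-]|_ ->]; first by rewrite mul0r.
  by exists 0 => //; rewrite mul0r.
by move=> /esym/eqP; rewrite -EFinM eqe mulf_eq0 (gt_eqF m0) orbF => /eqP.
Qed.

Lemma abs_gt0 a : (0 < abs a) = (a != 0).
Proof.
have [->|a0] := eqVneq a 0; first by rewrite abs0 ltxx.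
have [U [oU U0] [m m0 muU]] := open_finite_measure.
case: hmu => _ _ /(_ _ (open_scaling a0 oU)).
rewrite haar_scaling ?muU; last exact: measurable_borel_open.
rewrite -EFinM lte_fin pmulr_lgt0//; apply.
by exists (a * 0) => /=; exists 0.
Qed.

Lemma abs_eq0 a : (abs a == 0) = (a == 0).
Proof. by have := abs_gt0 a; rewrite lt_def abs_ge0 andbT => /negb_inj. Qed.

Lemma absM a b : abs (a * b) = abs a * abs b.
Proof.
have [->|b0] := eqVneq b 0; first by rewrite mulr0 abs0 mulr0.
have [U [oU U0] [m m0 muU]] := open_finite_measure.
have mU := measurable_borel_open oU.
have := haar_scaling (a * b) mU.
rewrite (_ : [set _ | _ in _] = [set a * x | x in [set b * x | x in U]]); last first.
  apply/seteqP; split=> [_ [x Ux <-]|_ [_ [x Ux <-] <-]].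
    by exists (b * x); rewrite ?mulrA//; exists x.
  by exists x; rewrite ?mulrA.
rewrite !haar_scaling ?muU; [|exact: mU|by apply: measurable_borel_open; exact: open_scaling].
by rewrite -!EFinM => -[] /eqP; rewrite mulrA (inj_eq (mulIf (lt0r_neq0 m0))) => /eqP.
Qed.

Lemma abs1 : abs 1 = 1.
Proof.
have /eqP := absM 1 1; rewrite mulr1 -subr_eq0 -{1}(mulr1 (abs 1)) -mulrBr mulf_eq0.
by rewrite abs_eq0 oner_eq0/= subr_eq0 => /eqP.
Qed.

Lemma absX a n : abs (a ^+ n) = abs a ^+ n.
Proof. by elim: n => [|n ih]; rewrite ?expr0 ?abs1// !exprS absM ih. Qed.

Lemma absV a : abs a^-1 = (abs a)^-1.
Proof.
have [->|a0] := eqVneq a 0; first by rewrite invr0 abs0 invr0.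
by apply: (mulfI (lt0r_neq0 (_ : 0 < abs a)));
  rewrite ?abs_gt0// -absM !divff ?abs1 ?abs_eq0.
Qed.

Lemma absN a : abs (- a) = abs a.
Proof.
suff : abs (-1) = 1 by move=> h; rewrite -mulN1r absM h mul1r.
have /eqP := absM (-1) (-1); rewrite mulrNN mulr1 abs1 eq_sym.
rewrite -expr2 sqrf_eq1 => /orP[/eqP//|/eqP h].
by have := abs_ge0 (-1); rewrite h ler0N1.
Qed.

Lemma absD_le a b c : abs a <= c -> abs b <= c -> abs (a + b) <= c.
Proof.
move=> ac bc; case: habs => _ /(_ a b) /le_trans; apply.
by rewrite ge_max ac.
Qed.

(** For a in A the set a U lies in the compact product A C, so |a| mu U <= mu (A C). The maximum
    with 1 in the witness makes the bound positive. *)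
Lemma abs_bounded_compact A : compact A -> exists2 M : R, 0 < M & forall a, A a -> abs a <= M.
Proof.
move=> cA.
have [U [C [oU U0 UC cC]]] := compact_nbhs0 hK.
have mU := measurable_borel_open oU.
have cAC : compact [set z.1 * z.2 | z in A `*` C].
  apply: continuous_compact; last exact: compact_setX.
  by apply: continuous_subspaceT => z; exact: (@tfmul_continuous K z).
case: hmu => _ /[dup] /(_ _ cC) muC /(_ _ cAC) muAC /(_ U oU (ex_intro _ _ U0)) muU.
have muUfin : mu U \is a fin_num.
  rewrite ge0_fin_numE//; apply: le_lt_trans muC; apply: le_measure => //=;
    rewrite inE//; exact: measurable_borel_compact.
have muACfin : mu [set z.1 * z.2 | z in A `*` C] \is a fin_num by rewrite ge0_fin_numE.
have mU0 : 0 < fine (mu U) by rewrite fine_gt0// muU/= -ge0_fin_numE.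
exists (Num.max 1 (fine (mu [set z.1 * z.2 | z in A `*` C]) / fine (mu U))).
  by rewrite lt_max ltr01.
move=> a Aa; rewrite le_max; apply/orP; right.
rewrite ler_pdivlMr// -lee_fin EFinM !fineK// -haar_scaling//.
have [->|a0] := eqVneq a 0.
  rewrite (_ : [set _ | _ in _] = [set 0]) ?haar_set1//.
  apply/seteqP; split => [_ [y _ <-]|_ ->]; first by rewrite mul0r.
  by exists 0 => //; rewrite mul0r.
apply: le_measure; rewrite ?inE.
- by apply: measurable_borel_open; exact: open_scaling.
- exact: measurable_borel_compact.
- by move=> _ [x Ux <-]; exists (a, x) => //; split => //=; exact: UC.
Qed.

Lemma abs_prime_lt1 : abs p < 1.
Proof. by case: hp. Qed.

Lemma subgroup_nbhs_open A : (exists2 U : set K, open U /\ U 0 & U `<=` A) ->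
  (forall x y, A x -> A y -> A (x + y)) -> open A.
Proof.
case=> U [oU U0] UA Aadd; rewrite openE => x Ax.
rewrite /interior nbhsE; exists [set x + y | y in U].
  by split; [exact: open_translation|exists 0; rewrite ?addr0].
by move=> _ [y /UA Uy <-]; exact: Aadd.
Qed.

(** Since |p| < 1, a power of p shrinks a bounded neighbourhood of 0 into the ball, which is closed
    under addition and hence open. That p != 0 is deduced only later, from [qM_abs_prime], and so
    stays an assumption here. *)
Lemma open_abs_le (c : R) : p != 0 -> 0 < c -> open [set x | abs x <= c].
Proof.
move=> p0 c0.
have [U [C [oU U0 UC cC]]] := compact_nbhs0 hK.
have [M M0 absC] := abs_bounded_compact cC.
apply: subgroup_nbhs_open; last by move=> x y; exact: absD_le.
have [n Mn] : exists n, M * abs p ^+ n <= c.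
  have : geometric M (abs p) @ \oo --> 0.
    by apply: cvg_geometric; rewrite ger0_norm ?abs_prime_lt1.
  move=> /cvgrPdist_le /(_ _ c0)[n _ /(_ n (leqnn _))]/=.
  rewrite sub0r normrN ger0_norm ?mulr_ge0 ?exprn_ge0 ?(ltW M0)// => Mn.
  by exists n.
exists [set p ^+ n * x | x in U].
  split; first by apply: open_scaling; rewrite ?expf_neq0.
  by exists 0; rewrite ?mulr0.
move=> _ [x /UC/absC xM <-] /=; rewrite absM absX mulrC.
by apply: le_trans Mn; rewrite ler_wpM2r ?exprn_ge0.
Qed.

Lemma prime_idealE : prime_ideal abs = [set p * x | x in integers abs].
Proof.
case: hp => p1 pmax; apply/seteqP; split=> [x x1|_ [x x1 <-]]; last first.
  by rewrite /prime_ideal/= absM; apply: le_lt_trans p1; rewrite ler_piMr.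
(* The case p = 0 is not excluded yet: maximality of |p| then makes the prime ideal {0}, and the
   identity persists. *)
have [p0|p0] := eqVneq p 0.
  have := pmax _ x1; rewrite p0 abs0 => x0.
  have /eqP : abs x == 0 by rewrite eq_le x0/=.
  move=> /eqP; rewrite abs_eq0 => /eqP ->; exists 0; last by rewrite mulr0.
  by rewrite /integers/= abs0.
exists (p^-1 * x); last by rewrite mulVKf.
by rewrite /integers/= absM absV mulrC ler_pdivrMr ?abs_gt0// mul1r; exact: pmax.
Qed.

Lemma measurable_prime_ideal : measurable (prime_ideal abs : set (borel K)).
Proof.
rewrite prime_idealE; have [->|p0] := eqVneq p 0.
  rewrite (_ : image _ _ = [set 0]).
    by apply: measurable_borel_compact => //; exact: compact_set1.
  apply/seteqP; split=> [_ [x _ <-]|_ ->]; first by rewrite mul0r.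
  by exists 0; rewrite ?mulr0// /integers/= abs0.
apply: measurable_borel_open; apply: open_scaling => //.
by apply: open_abs_le.
Qed.

Lemma haar_prime_ideal : mu (prime_ideal abs) = (abs p)%:E.
Proof.
have [p0|p0] := eqVneq p 0; last first.
  rewrite prime_idealE haar_scaling ?hnormalized ?mule1//.
  by apply: measurable_borel_open; exact: open_abs_le.
rewrite p0 abs0 -[RHS](haar_set1 0); congr (mu _).
rewrite prime_idealE p0; apply/seteqP; split=> [_ [x _ <-]|_ ->] /=; first by rewrite mul0r.
by exists 0; rewrite ?mulr0// /integers/= abs0.
Qed.

Lemma prime_idealB x y : prime_ideal abs x -> prime_ideal abs y -> prime_ideal abs (x - y).
Proof.
move=> x1 y1; case: habs => _ /(_ x (- y)) h; rewrite /prime_ideal/=.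
by apply: le_lt_trans h _; rewrite absN gt_max; apply/andP.
Qed.

(** The integers have measure 1 and are the disjoint union of q cosets of the prime ideal, each of
    measure |p|. *)
Lemma qM_abs_prime : q%:R * abs p = 1.
Proof.
have [f [ff fi fs]] := card_set_bijP (card_esym hq).
have fE i : (i < q)%N -> exists2 x, integers abs x & f i = [set x + y | y in prime_ideal abs].
  by move=> iq; have [x xD xE] := ff i iq; exists x.
have mf i : (i < q)%N -> measurable (f i : set (borel K)).
  move=> /fE[x _ ->]; apply: measurable_translation; exact: measurable_prime_ideal.
have muf i : (i < q)%N -> mu (f i) = (abs p)%:E.
  move=> /fE[x _ ->]; rewrite haar_translation ?haar_prime_ideal//.
  exact: measurable_prime_ideal.
have tf : trivIset `I_q f.
  move=> i j /= iq jq [z []]; have [x xD fi_] := fE i iq; have [y yD fj_] := fE j jq.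
  rewrite fi_ fj_ => -[u Pu uz] [v Pv vz]; apply: fi; rewrite ?inE// fi_ fj_.
  have xy : prime_ideal abs (x - y).
    rewrite (_ : x - y = v - u); last first.
      by apply/eqP; rewrite subr_eq -addrA (addrC _ y) addrA -subr_eq opprK uz addrC vz.
    exact: prime_idealB.
  apply/seteqP; split=> _ [w Pw <-]; [exists (w - (y - x))|exists (w - (x - y))].
  - by apply: prime_idealB => //; rewrite -opprB /prime_ideal/= absN.
  - by rewrite opprB addrCA [y + _]addrC subrK addrC.
  - exact: prime_idealB.
  - by rewrite opprB addrCA [x + _]addrC subrK addrC.
have DE : integers abs = \bigcup_(i in `I_q) f i.
  apply/seteqP; split=> [x xD|x [i iq]].
    have [|i iq fix_] := fs [set x + y | y in prime_ideal abs]; first by exists x.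
    exists i => //; rewrite fix_; exists 0; rewrite ?addr0//.
    by rewrite /prime_ideal/= abs0.
  have [y yD ->] := fE i iq => -[z Pz <-].
  by rewrite /integers/=; apply: absD_le => //; exact: ltW.
move: hnormalized; rewrite DE bigcup_mkord.
rewrite measure_semi_additive_ord_I//; last first.
  by apply: bigsetU_measurable => i _; exact: mf.
rewrite (eq_bigr (fun=> (abs p)%:E)); last by move=> i _; exact: muf.
by rewrite sumEFin sumr_const card_ord => -[h]; rewrite mulr_natl h.
Qed.

Lemma prime_neq0 : p != 0.
Proof.
apply/eqP => p0; have := qM_abs_prime.
by rewrite p0 abs0 mulr0 => /esym/eqP; rewrite oner_eq0.
Qed.
#[local] Hint Resolve prime_neq0 : core.

Lemma residue_card_gt0 : 0 < q%:R :> R.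
Proof.
have : 0 < q%:R * abs p by rewrite qM_abs_prime.
by rewrite pmulr_lgt0// abs_gt0 prime_neq0.
Qed.
#[local] Hint Resolve residue_card_gt0 : core.

Lemma residue_card_gt1 : 1 < q%:R :> R.
Proof.
by rewrite -[ltLHS]qM_abs_prime -[ltRHS]mulr1 ltr_pM2l ?residue_card_gt0//; case: hp.
Qed.
#[local] Hint Resolve residue_card_gt1 : core.

Lemma abs_prime : abs p = q%:R^-1.
Proof.
by apply: (mulfI (lt0r_neq0 residue_card_gt0)); rewrite qM_abs_prime divff// lt0r_neq0.
Qed.

Lemma abs_exprz k : abs (p ^ k) = q%:R ^ (- k).
Proof.
case: k => n.
  by rewrite -exprnP absX abs_prime -exprnN exprVn.
by rewrite NegzE -exprnN absV absX abs_prime exprVn invrK opprK.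
Qed.

Lemma integersE : integers abs = Pid 0.
Proof. by rewrite /Pideal oppr0 expr0z. Qed.

Lemma Pideal_le j k : j <= k -> Pid k `<=` Pid j.
Proof.
move=> jk x /= xk; apply: le_trans xk _.
by rewrite ler_eXz2l ?residue_card_gt1 ?lerN2.
Qed.

Lemma Pideal0 k : Pid k 0.
Proof. by rewrite /Pideal/= abs0 exprz_ge0. Qed.
#[local] Hint Resolve Pideal0 : core.

Lemma PidealD k x y : Pid k x -> Pid k y -> Pid k (x + y).
Proof. by rewrite /Pideal/= => xk yk; exact: absD_le. Qed.

Lemma PidealN k x : Pid k x -> Pid k (- x).
Proof. by rewrite /Pideal/= absN. Qed.

Lemma PidealB k x y : Pid k x -> Pid k y -> Pid k (x - y).
Proof. by move=> xk yk; apply: PidealD => //; exact: PidealN. Qed.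

Lemma PidealM j k x y : Pid j x -> Pid k y -> Pid (j + k) (x * y).
Proof.
rewrite /Pideal/= absM opprD expfzDr ?lt0r_neq0 ?residue_card_gt0// => xj yk.
exact: ler_pM.
Qed.

Lemma Pideal_prime_exprz k : Pid k (p ^ k).
Proof. by rewrite /Pideal/= abs_exprz. Qed.

Lemma Pideal_scaling j k x : Pid (j + k) (p ^ j * x) <-> Pid k x.
Proof.
split=> [h|]; last by apply: PidealM; exact: Pideal_prime_exprz.
have := PidealM (Pideal_prime_exprz (- j)) h.
by rewrite mulrA -expfzDr ?prime_neq0// addNr expr0z mul1r addKr.
Qed.

Lemma Pideal_image k : Pid k = [set p ^ k * x | x in integers abs].
Proof.
rewrite integersE; apply/seteqP; split=> [x xk|_ [x xD <-]].
  exists (p ^ (- k) * x); last by rewrite mulrA -expfzDr ?prime_neq0// addrN expr0z mul1r.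
  by rewrite -(addNr k); apply/Pideal_scaling.
by have := (Pideal_scaling k 0 x).2 xD; rewrite addr0.
Qed.

(** No absolute value lies strictly between q^(-k) and q^(1-k): if |x| > q^(-k), then p^k / x is in
    the prime ideal, so its absolute value is at most |p| = 1/q. *)
Lemma Pideal_gap k x : ~ Pid k x -> Pid (1 - k) x^-1.
Proof.
rewrite /Pideal/= => /negP; rewrite -ltNge => xk.
have x0 : x != 0.
  by rewrite -abs_gt0; apply: le_lt_trans xk; rewrite exprz_ge0.
case: hp => _ /(_ (p ^ k * x^-1)).
rewrite /prime_ideal/= absM absV abs_exprz ltr_pdivrMr ?abs_gt0// mul1r => /(_ xk).
rewrite abs_prime -ler_pdivlMl ?exprz_gt0 ?residue_card_gt0//.
by rewrite invr_expz opprK opprB expfzDr ?lt0r_neq0 ?residue_card_gt0.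
Qed.

Lemma Pideal_open k : open (Pid k).
Proof.
apply: (open_abs_le prime_neq0).
by rewrite exprz_gt0 ?residue_card_gt0.
Qed.
#[local] Hint Resolve Pideal_open : core.

Lemma cballP k a x : cb k a x <-> Pid k (x - a).
Proof.
split=> [[y yk <-]|xk]; first by rewrite addrC addKr.
by exists (x - a) => //; rewrite subrKC.
Qed.

Lemma cball_refl k a : cb k a a.
Proof. by apply/cballP; rewrite subrr; exact: Pideal0. Qed.

Lemma cball_sym k a b : cb k a b -> cb k b a.
Proof. by move=> /cballP h; apply/cballP; rewrite -opprB; exact: PidealN. Qed.

Lemma cball_trans k a b x : cb k a b -> cb k b x -> cb k a x.
Proof.
move=> /cballP h1 /cballP h2; apply/cballP.
by rewrite -(subrK b x) -addrA; exact: PidealD.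
Qed.

Lemma cball_eq k a b : cb k a b -> cb k a = cb k b.
Proof.
move=> ab; apply/seteqP; split=> x; last exact: cball_trans.
by apply: cball_trans; exact: cball_sym.
Qed.

Lemma cball_le j k a : j <= k -> cb k a `<=` cb j a.
Proof. by move=> jk x /cballP/(Pideal_le jk) h; exact/cballP. Qed.

Lemma cball0 k : cb k 0 = Pid k.
Proof. by apply/seteqP; split=> x; [move=> /cballP|move=> ?; apply/cballP]; rewrite subr0. Qed.

Lemma cball_open k a : open (cb k a).
Proof. by apply: open_translation; exact: Pideal_open. Qed.

Lemma cball_closed k a : closed (cb k a).
Proof.
rewrite -[cb _ _]setCK; apply: open_closedC; rewrite openE => x xk.
rewrite /interior nbhsE; exists (cb k x).
  by split; [exact: cball_open|exact: cball_refl].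
move=> y xy ky; apply: xk; apply: cball_trans ky _; exact: cball_sym.
Qed.

Lemma measurable_cball k a : measurable (cb k a : set (borel K)).
Proof. by apply: measurable_borel_open; exact: cball_open. Qed.
#[local] Hint Resolve measurable_cball : core.

Lemma haar_cball k a : mu (cb k a) = (q%:R ^ (- k))%:E.
Proof.
rewrite haar_translation; last by rewrite -cball0; exact: measurable_cball.
rewrite Pideal_image haar_scaling ?hnormalized ?mule1 ?abs_exprz//.
by rewrite integersE -cball0; exact: measurable_cball.
Qed.

(** * Compactness of balls *)

Fixpoint packed (A W : set K) (s : seq K) : Prop :=
  if s is x :: s' then
    [/\ A x, packed A W s' &
      forall y, y \in s' -> [set x + w | w in W] `&` [set y + w | w in W] = set0]
  else True.

Lemma packed_bound A W s : measurable (A : set (borel K)) -> open W ->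
  (forall x w, A x -> W w -> A (x + w)) -> packed A W s ->
  ((size s)%:R%:E * mu W <= mu A)%E.
Proof.
move=> mA oW AW ps.
have mW x : measurable ([set x + w | w in W] : set (borel K)).
  by apply: measurable_borel_open; exact: open_translation.
have -> : ((size s)%:R%:E * mu W =
    mu (\big[setU/set0]_(x <- s) [set (x + w)%R | w in W]))%E.
  elim: s ps => [_|x s ih /= [_ /ih{}ih disj]]; first by rewrite big_nil mul0e measure0.
  rewrite big_cons (@measureU _ _ _ mu)//; last 2 first.
  - exact: bigsetU_measurable.
  - rewrite big_distrr/= big_seq; apply: big1 => y ys; exact: disj.
  rewrite /= -ih haar_translation; last exact: measurable_borel_open.
  by rewrite -natr1 EFinD ge0_muleDl ?lee_fin// mul1e addeC.
apply: le_measure; rewrite ?inE//; first exact: bigsetU_measurable.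
elim: s ps => [_|x s ih /= [Ax ps _]]; first by rewrite big_nil.
rewrite big_cons => y [[w Ww <-]|]; first exact: AW.
exact: ih.
Qed.

(** Each translate of W uses up mu W > 0 of the finite measure of A, so a packing of maximal length
    exists. By maximality y + W meets some x + W, that is, y lies in x + (W - W). This serves both
    the compactness of the integers and the countability of cosets. *)
Lemma finite_packing A W : measurable (A : set (borel K)) -> (mu A < +oo)%E ->
  open W -> W 0 -> (forall x w, A x -> W w -> A (x + w)) ->
  exists s : seq K, forall y, A y ->
    exists x v w, [/\ x \in s, W v, W w & y = x + (v - w)].
Proof.
move=> mA Afin oW W0 AW.
have muW : (0 < mu W)%E by case: hmu => _ _; apply => //; exists 0.
pose P n := `[< exists s, size s = n /\ packed A W s >].
have P0 : exists n, P n by exists 0; apply/asboolP; exists [::].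
have [m Pm] : exists m, forall n, P n -> (n <= m)%N.
  (* A real lower bound is wanted because mu W could be +oo as far as this point knows; then e = 1
     does. *)
  have [e e0 eW] : exists2 e : R, 0 < e & (e%:E <= mu W)%E.
    case: (mu W) muW => [e||//]; first by rewrite lte_fin => e0; exists e.
    by move=> _; exists 1; rewrite ?leey.
  exists (Num.bound (fine (mu A) / e)) => n /asboolP[s [<- ps]].
  have := packed_bound mA oW AW ps.
  have Af : mu A \is a fin_num by rewrite ge0_fin_numE.
  move=> h; rewrite -(ler_nat R); apply: (le_trans _ (ltW (archi_boundP _))); last first.
    by rewrite divr_ge0 ?fine_ge0// ltW.
  rewrite ler_pdivlMr//; rewrite -lee_fin fineK// EFinM; apply: le_trans h.
  by rewrite lee_wpmul2l ?lee_fin.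
case: (ex_maxnP P0 Pm) => n /asboolP[s [sn ps]] nmax.
exists s => y Ay; apply: contrapT => ny.
suff /nmax : P n.+1 by rewrite ltnn.
apply/asboolP; exists (y :: s); split; first by rewrite /= sn.
split=> // x xs; apply/seteqP; split=> // z [[w Ww wz] [v Vv vz]].
apply: ny; exists x, v, w; split=> //.
by rewrite addrA vz -wz addrK.
Qed.

Lemma integers_compact : compact (integers abs).
Proof.
have [U [C [oU U0 UC cC]]] := compact_nbhs0 hK.
have [W [oW W0 WD WU]] : exists W : set K, [/\ open W, W 0, W `<=` integers abs &
    forall v w, W v -> W w -> U (v - w)].
  have : nbhs (0 - 0) U by rewrite subrr; apply: open_nbhs_nbhs.
  move=> /(@sub_continuous K (0, 0))[[A B] /= [A0 B0] AB].
  (* Intersecting with the integers keeps the translates x + W inside them, where they can be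
     counted by measure. *)
  exists (A° `&` B° `&` integers abs); split.
  - by rewrite integersE; apply: openI; [apply: openI; exact: open_interior|exact: Pideal_open].
  - by split=> //; rewrite integersE.
  - by move=> x [].
  - move=> v w [[Av _] _] [[_ Bw] _].
    by apply: (AB (v, w)); split; exact: interior_subset.
have mD : measurable (integers abs : set (borel K)).
  by rewrite integersE; exact: measurable_borel_open.
have [|x w xD /WD wD|s hs] := finite_packing mD _ oW W0.
- by rewrite hnormalized ltry.
- by rewrite /integers/=; exact: absD_le.
apply: (@subclosed_compact _ _ (\big[setU/set0]_(x <- s) [set x + c | c in C])).
- by rewrite integersE -cball0; exact: cball_closed.
- by apply: bigsetU_compact => x _; exact: compact_translation.
- move=> y /hs[x [v [w [xs Wv Ww ->]]]].
  rewrite -bigcup_seq; exists x => //; exists (v - w) => //.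
  by apply: UC; exact: WU.
Qed.

Lemma Pideal_compact k : compact (Pid k).
Proof.
rewrite Pideal_image; apply: continuous_compact; last exact: integers_compact.
by apply: continuous_subspaceT => x; exact: continuous_scaling.
Qed.

Lemma cball_compact k a : compact (cb k a).
Proof. by apply: compact_translation; exact: Pideal_compact. Qed.

Lemma compact_sub_Pideal A : compact A -> exists n : nat, A `<=` Pid (- n%:Z).
Proof.
move=> /abs_bounded_compact[M M0 AM].
have q1 : (1 < q)%N by rewrite -(ltr_nat R).
exists (Num.bound M) => x /AM xM; rewrite /Pideal/= opprK; apply: (le_trans xM).
rewrite -exprnP; apply: (le_trans (ltW (archi_boundP (ltW M0)))).
by rewrite -natrX ler_nat ltnW// ltn_expl.
Qed.

Lemma Pideal_separated x : x != 0 -> exists n : nat, ~ Pid n x.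
Proof.
move=> x0; have q1 : (1 < q)%N by rewrite -(ltr_nat R).
exists (Num.bound (abs x)^-1); rewrite /Pideal/=; apply/negP; rewrite -ltNge.
rewrite -invr_expz invf_plt ?posrE ?abs_gt0 ?exprz_gt0//.
rewrite -exprnP; apply: lt_le_trans (archi_boundP _) _; first by rewrite invr_ge0.
by rewrite -natrX ler_nat ltnW// ltn_expl.
Qed.

(** Each point of the compact set D \ U is nonzero and hence has a neighbourhood missed by all small
    P^n; by compactness a single P^n misses D \ U. So the balls form a base at 0. *)
Lemma Pideal_nbhs0 U : open U -> U 0 -> exists n : nat, Pid n `<=` U.
Proof.
move=> oU U0.
have cDU : compact (Pid 0 `&` ~` U).
  apply: (@subclosed_compact _ _ (Pid 0)); [|exact: Pideal_compact|by move=> x []].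
  apply: closedI; last exact: open_closedC.
  by rewrite -cball0; exact: cball_closed.
move/compact_near_coveringP : cDU => /(_ nat \oo (fun n x => ~ Pid n%:Z x) _)[].
  move=> x [xD xU].
  have [|N xN] := @Pideal_separated x.
    by apply/eqP => x0; apply: xU; rewrite x0.
  exists (~` Pid N, [set n | (N <= n)%N]) => /=.
    split; last by exists N.
    apply: open_nbhs_nbhs; split=> //; apply: closed_openC.
    by rewrite -cball0; exact: cball_closed.
  by move=> [y n] /= [yN Nn] /Pideal_le yn; apply/yN/yn; rewrite lez_nat.
move=> n _ /(_ n (leqnn _)) h; exists n => x xn; apply: contrapT => xU.
by apply: (h x) => //; split=> //; exact: Pideal_le xn.
Qed.

(** The balls P^(-n) exhaust K, and a maximal packing by translates of P^k yields finitely many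
    cosets for each n. The pairs (n, position in the list) are coded by [pickle]. *)
Lemma countable_cosets k : exists a : nat -> K, forall x, exists n, cb k (a n) x.
Proof.
have Pk0 := Pideal0 k.
have h (n : nat) : exists s : seq K, forall x, Pid (- n%:Z) x ->
    exists2 y, y \in s & cb k y x.
  (* P^m must contain P^(-n), which is to be covered, and P^k, so that it is stable under adding
     elements of P^k. *)
  have [m mn mk] : exists2 m : int, m <= - n%:Z & m <= k.
    by exists (Num.min (- n%:Z) k); rewrite ge_min lexx ?orbT.
  have fin : (mu (Pid m) < +oo)%E by rewrite -cball0 haar_cball ltry.
  have mP : measurable (Pid m : set (borel K)) by exact: measurable_borel_open.
  have [|s hs] := finite_packing mP fin (Pideal_open k) Pk0.
    by move=> x w xm /(Pideal_le mk) wm; exact: PidealD.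
  exists s => x /(Pideal_le mn)/hs[y [v [w [ys vk wk ->]]]]; exists y => //.
  by exists (v - w) => //; exact: PidealB.
have [s sP] := choice h.
exists (fun i => if unpickle i is Some (n, j) then nth 0 (s n) j else 0) => x.
have [n xn] := compact_sub_Pideal (@compact_set1 _ x).
have [y ys yx] := sP n x (xn _ erefl).
exists (pickle (n, index y (s n))); rewrite pickleK.
by rewrite nth_index.
Qed.

(** * Change of variables and integration over cosets *)

(** The push-forward formula handles the positive and negative parts; their infinite values are then
    compared case by case. Hence mere measurability suffices, and the change of variables for
    [cintegral] inherits this. *)
Lemma integral_comp_scale (T : K -> K) (c : R) (f : K -> \bar R) : 0 < c ->
  measurable_fun [set: borel K] (T : borel K -> borel K) ->
  (forall A, measurable (A : set (borel K)) -> mu (T @^-1` A) = (c%:E * mu A)%E) ->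
  measurable_fun [set: borel K] (f : borel K -> \bar R) ->
  (\int[mu]_x f (T x) = c%:E * \int[mu]_x f x)%E.
Proof.
move=> c0 mT muT.
have ge0 (g : K -> \bar R) : measurable_fun [set: borel K] (g : borel K -> \bar R) ->
    (forall x, 0 <= g x)%E -> (\int[mu]_x g (T x) = c%:E * \int[mu]_x g x)%E.
  move=> mg g0; pose c' : {nonneg R} := NngNum (ltW c0).
  have := @ge0_integral_pushforward _ _ (borel K) (borel K) R T mT mu setT g
    measurableT mg (fun y _ => g0 y).
  rewrite preimage_setT => <-.
  rewrite (eq_measure_integral (mscale c' mu)); last by move=> A mA _; exact: muT.
  by rewrite ge0_integral_mscale.
move=> mf; rewrite integralE [X in (_ * X)%E]integralE.
have -> : (\int[mu]_x (fun x : borel K => f (T x))^\+ x = c%:E * \int[mu]_x f^\+ x)%E.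
  rewrite -[RHS](ge0 _ (measurable_funepos mf) (fun x => funepos_ge0 _ _)).
  by apply: eq_integral => x _; rewrite !funeposE.
have -> : (\int[mu]_x (fun x : borel K => f (T x))^\- x = c%:E * \int[mu]_x f^\- x)%E.
  rewrite -[RHS](ge0 _ (measurable_funeneg mf) (fun x => funeneg_ge0 _ _)).
  by apply: eq_integral => x _; rewrite !funenegE.
have : (0 <= \int[mu]_x f^\+ x)%E by apply: integral_ge0.
have : (0 <= \int[mu]_x f^\- x)%E by apply: integral_ge0.
case: (\int[mu]_x f^\- x)%E => [b||]//; case: (\int[mu]_x f^\+ x)%E => [a||]// _ _.
- by rewrite -!EFinM -!EFinB mulrBr.
- by rewrite /= gt0_muley ?lte_fin// -EFinM.
- by rewrite /= gt0_muley ?lte_fin// gt0_muleNy ?lte_fin.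
- by rewrite /= gt0_muley ?lte_fin// gt0_muleNy ?lte_fin.
Qed.

Lemma integral_translation a (f : K -> \bar R) :
  measurable_fun [set: borel K] (f : borel K -> \bar R) ->
  (\int[mu]_x f (a + x)%R = \int[mu]_x f x)%E.
Proof.
move=> mf; rewrite (@integral_comp_scale (fun x => a + x) 1)//.
- by rewrite mul1e.
- exact: (continuous_borel_measurable (@continuous_translation _ a)).
- move=> A mA; rewrite mul1e -(haar_translation (- a) mA).
  by rewrite translationE opprK.
Qed.

Lemma integral_scaling a (f : K -> \bar R) : a != 0 ->
  measurable_fun [set: borel K] (f : borel K -> \bar R) ->
  (\int[mu]_x f (a * x)%R = (abs a)^-1%:E * \int[mu]_x f x)%E.
Proof.
move=> a0 mf; rewrite (@integral_comp_scale (fun x => a * x) (abs a)^-1)//.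
- by rewrite invr_gt0 abs_gt0.
- exact: (continuous_borel_measurable (@continuous_scaling _ a)).
- move=> A mA; rewrite -absV -(haar_scaling _ mA).
  by rewrite scalingE ?invr_neq0// invrK.
Qed.

(** Two cosets are equal or disjoint, so making an enumeration of them disjoint leaves each one
    whole or empties it. *)
Lemma coset_partition k : exists F : nat -> set K,
  [/\ trivIset setT F, \bigcup_n F n = setT &
      forall n, F n = set0 \/ exists a, F n = cb k a].
Proof.
have [a ak] := countable_cosets k.
exists (seqDU (fun n => cb k (a n))); split.
- exact: trivIset_seqDU.
- rewrite -seqDU_bigcup_eq; apply/seteqP; split=> // x _.
  by have [n] := ak x; exists n.
- move=> n; rewrite /seqDU -(bigcup_mkord n (fun n => cb k (a n))).
  have [[i [ij ai]]|ni] := pselect (exists i, (i < n)%N /\ cb k (a n) (a i)).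
    left; apply/seteqP; split=> // x [xn]; apply.
    exists i => //; apply: cball_trans xn.
    exact: cball_sym.
  right; exists (a n); apply/seteqP; split=> x; first by case.
  move=> xn; split=> // -[i ij xi]; apply: ni.
  exists i; split=> //; apply: cball_trans xn _.
  exact: cball_sym.
Qed.

Lemma ge0_le_integral_cosets k (u v : K -> \bar R) :
  measurable_fun [set: borel K] (u : borel K -> \bar R) ->
  measurable_fun [set: borel K] (v : borel K -> \bar R) ->
  (forall x, 0 <= u x)%E -> (forall x, 0 <= v x)%E ->
  (forall a, \int[mu]_(x in cb k a) u x <= \int[mu]_(x in cb k a) v x)%E ->
  (\int[mu]_x u x <= \int[mu]_x v x)%E.
Proof.
move=> mu_ mv u0 v0 uv; have [F [tF FT Fk]] := coset_partition k.
have mF n : measurable (F n : set (borel K)).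
  by case: (Fk n) => [->|[a ->]]; [exact: measurable0|exact: measurable_cball].
rewrite -[X in (\int[mu]_(x in X) u x <= _)%E]FT -[X in (_ <= \int[mu]_(x in X) v x)%E]FT.
rewrite !ge0_integral_bigcup//; [|by rewrite FT|by rewrite FT].
apply: lee_nneseries => n _; first by move=> _; apply: integral_ge0.
by case: (Fk n) => [->|[a ->]]; rewrite ?integral_set0// uv.
Qed.

Lemma eq_integral_cosets k (u v : K -> \bar R) :
  mu.-integrable setT (u : borel K -> \bar R) -> mu.-integrable setT (v : borel K -> \bar R) ->
  (forall a, \int[mu]_(x in cb k a) u x = \int[mu]_(x in cb k a) v x)%E ->
  (\int[mu]_x u x = \int[mu]_x v x)%E.
Proof.
move=> iu iv uv; have [F [tF FT Fk]] := coset_partition k.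
have mF n : measurable (F n : set (borel K)).
  by case: (Fk n) => [->|[a ->]]; [exact: measurable0|exact: measurable_cball].
rewrite -[X in (\int[mu]_(x in X) u x = _)%E]FT -[X in (_ = \int[mu]_(x in X) v x)%E]FT.
rewrite !integral_bigcup//; [|by rewrite FT|by rewrite FT].
apply: eq_eseriesr => n _.
by case: (Fk n) => [->|[a ->]]; rewrite ?integral_set0// uv.
Qed.

(** The empty set is included so that the family is stable under intersection, as Dynkin's theorem
    requires. *)
Definition cballs : set (set K) := [set A | A = set0 \/ exists k a, A = cb k a].

Lemma cballs_setI : setI_closed cballs.
Proof.
move=> A B [->|[j [a ->]]]; first by move=> _; left; rewrite set0I.
move=> [->|[k [b ->]]]; first by left; rewrite setI0.
have [[x [xa xb]]|ne] := pselect (cb j a `&` cb k b !=set0); last first.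
  by left; apply/eqP/negPn; apply/negP => /set0P.
rewrite (cball_eq xa) (cball_eq xb); right.
have [jk|/ltW kj] := leP j k.
  by exists k, x; apply/setIidPr; exact: cball_le.
by exists j, x; apply/setIidPl; exact: cball_le.
Qed.

Lemma borel_cballs : measurable = <<s (cballs : set (set (borel K))) >>.
Proof.
apply/seteqP; split; last first.
  apply: smallest_sub; first exact: sigma_algebra_measurable.
  by move=> _ [->|[k [a ->]]]; [exact: measurable0|exact: measurable_cball].
apply: smallest_sub; first exact: smallest_sigma_algebra.
move=> U oU.
have /choice[a aP] (n : nat) : exists a : nat -> K, forall x, exists i, cb n (a i) x.
  exact: countable_cosets.
pose F (n i : nat) : set (borel K) :=
  if `[< cb n (a n i) `<=` U >] then cb n (a n i) else set0.
suff -> : U = \bigcup_n \bigcup_i F n i.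
  apply: sigma_algebra_bigcup => n; apply: sigma_algebra_bigcup => i.
  rewrite /F; case: asboolP => _; last exact: sigma_algebra0.
  by apply: sub_sigma_algebra; right; exists n, (a n i).
apply/seteqP; split=> [x Ux|x [n _ [i _]]]; last first.
  by rewrite /F; case: asboolP => // h /h.
have oxU : open [set - x + y | y in U] by exact: open_translation.
have [|n nU] := Pideal_nbhs0 oxU.
  by exists x => //; rewrite addNr.
have [i xi] := aP n x.
exists n => //; exists i => //; rewrite /F; case: asboolP => // -[].
move=> y yi; have /cballP/nU[z Uz] : cb n x y.
  by apply: cball_trans yi; exact: cball_sym.
by rewrite addrC => /addIr <-.
Qed.

(** The sets E for which w has integral 0 over the part of E in P^(-n) form a Dynkin class
    containing the balls. The cut by P^(-n) is there because w is integrable on balls only; the null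
    sets are united over n at the end. *)
Lemma cballs_integral0_ae (w : K -> R) :
  measurable_fun [set: borel K] (w : borel K -> R) ->
  (forall k a, mu.-integrable (cb k a : set (borel K)) (fun x => (w x)%:E)) ->
  (forall k a, \int[mu]_(x in cb k a) (w x)%:E = 0)%E ->
  \forall x \ae mu, w x = 0.
Proof.
move=> mw iw w0; have bE := borel_cballs.
pose D (n : nat) : set (borel K) := cb (- n%:Z) 0.
have mD n : measurable (D n) by exact: measurable_cball.
have mwE (A : set (borel K)) : measurable_fun A (fun x : borel K => (w x)%:E).
  by apply: measurable_funTS; apply/measurable_EFinP.
have wD n (E : set (borel K)) : measurable E -> (\int[mu]_(x in E `&` D n) (w x)%:E = 0)%E.
  rewrite bE.
  apply: (@dynkin_induction _ (borel K) cballs (fun E => \int[mu]_(x in E `&` D n) (w x)%:E = 0)%E).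
  - exact: bE.
  - exact: cballs_setI.
  - by rewrite setTI; exact: w0.
  - move=> A cA; have : cballs (A `&` D n).
      by apply: cballs_setI => //; right; exists (- n%:Z), 0.
    by move=> [->|[k [a ->]]]; [rewrite integral_set0|exact: w0].
  - move=> A mA A0; have : (\int[mu]_(x in D n) (w x)%:E = 0)%E by exact: w0.
    rewrite -{1}(setTI (D n)) -(setvU A) setIUl integral_setU//.
    + by rewrite A0 adde0.
    + by apply: measurableI => //; exact: measurableC.
    + exact: measurableI.
    + apply/eqP/seteqP; split=> // x [[nA _] [hA _]]; exact: nA.
  - move=> F mF tF F0; rewrite setI_bigcupl integral_bigcup.
    + by rewrite eseries0.
    + by apply: trivIset_setIr.
    + by move=> i; exact: measurableI.
    + rewrite -setI_bigcupl; apply: integrableS (iw (- n%:Z) 0) => //.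
      * apply: measurableI => //; exact: bigcup_measurable.
have ae0 n : \forall x \ae mu, D n x -> w x = 0.
  have := @integral_ae_eq _ (borel K) R mu (D n) (mD n) (cst 0%E) (fun x => (w x)%:E).
  move=> /(_ (iw _ _) (measurable_cst _)) h.
  have : ae_eq mu (D n) (fun x : borel K => (w x)%:E) (cst 0%E).
    apply: h => E ED mE; rewrite integral0.
    by rewrite -(wD n E mE) (setIidl ED).
  by apply: filterS => x /= h' /h' [].
have := ae_foralln ae0; apply: filterS => x wx.
have [n xn] := compact_sub_Pideal (@compact_set1 _ x).
by apply: (wx n); rewrite /D cball0; exact: xn.
Qed.

Lemma cmeasurable_comp h (T : K -> K) :
  measurable_fun [set: borel K] (T : borel K -> borel K) -> cmeasurable h ->
  cmeasurable (fun x => h (T x)).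
Proof.
move=> mT [rh jh].
by split; [exact: (measurableT_comp rh mT)|exact: (measurableT_comp jh mT)].
Qed.

Lemma cintegral_translation a h : cmeasurable h ->
  cintegral (fun x => h (a + x)) = cintegral h.
Proof.
move=> [rh jh]; rewrite /cintegral /Rintegral.
by rewrite (integral_translation a ((measurable_EFinP _ _).2 rh))
  (integral_translation a ((measurable_EFinP _ _).2 jh)).
Qed.

Lemma cintegral_scaling a h : a != 0 -> cmeasurable h ->
  cintegral (fun x => h (a * x)) = ((abs a)^-1)%:C%C * cintegral h.
Proof.
move=> a0 [rh jh]; rewrite /cintegral /Rintegral.
rewrite (integral_scaling a0 ((measurable_EFinP _ _).2 rh))
  (integral_scaling a0 ((measurable_EFinP _ _).2 jh)).
have fineZ (x : \bar R) : fine ((abs a)^-1%:E * x) = (abs a)^-1 * fine x.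
  have a1 : (0 < (abs a)^-1%:E)%E by rewrite lte_fin invr_gt0 abs_gt0.
  by case: x => [x||] //=; rewrite ?(gt0_muley a1) ?(gt0_muleNy a1)//= mulr0.
rewrite !fineZ; set u := fine _; set v := fine _.
by apply/eqP; rewrite eq_complex /= !mul0r subr0 addr0 !eqxx.
Qed.

Lemma locally_constant_cmeasurable k f : (forall x y, Pid k (x - y) -> f x = f y) ->
  cmeasurable f.
Proof.
move=> fk; have op (g : K -> R) : (forall x y, Pid k (x - y) -> g x = g y) ->
    measurable_fun [set: borel K] (g : borel K -> R).
  move=> gk _ Y mY; rewrite setTI; apply: measurable_borel_open.
  rewrite openE => x gx; rewrite /interior nbhsE; exists (cb k x).
    by split; [exact: cball_open|exact: cball_refl].
  by move=> y /cballP yx /=; rewrite (gk _ _ yx).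
by split; apply: op => x y /fk ->.
Qed.

(** * The Fourier transform and low-pass operators *)

Lemma chiD x y : chi (x + y) = chi x * chi y.
Proof. by case: hchi => -[h _] _ _ _; exact: h. Qed.

Lemma normc_chi x : normc (chi x) = 1.
Proof. by case: hchi => -[_ h] _ _ _; exact: h. Qed.

Lemma chi_integers x : Pid 0 x -> chi x = 1.
Proof. by rewrite -integersE; case: hchi => _ _ h _; exact: h. Qed.

Lemma chi_conj x : (chi x)^*%C = chi (- x).
Proof.
have c0 : chi x != 0.
  by apply/eqP => c0; have := normc_chi x; rewrite c0 Normc.normc0 => /esym/eqP; rewrite oner_eq0.
apply: (mulfI c0); rewrite -chiD subrr (chi_integers (Pideal0 0)).
have := normc_chi x; case: (chi x) => a b /= ab.
have /(congr1 (fun u : R => u ^+ 2)) := ab; rewrite sqr_sqrtr ?addr_ge0 ?sqr_ge0// expr1n => {}ab.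
apply/eqP; rewrite eq_complex /= mulrN opprK -!expr2 ab eqxx/=.
by rewrite mulrN addrC mulrC subrr.
Qed.

Lemma cmeasurable_chi c : cmeasurable (fun x => chi (c * x)).
Proof.
have [n cn] := compact_sub_Pideal (@compact_set1 _ c).
apply: (@locally_constant_cmeasurable n) => x y xy.
rewrite -[x](subrK y) mulrDr chiD chi_integers ?mul1r//.
have := PidealM (cn _ erefl) xy.
by rewrite addNr.
Qed.

Lemma measurable_Pideal k : measurable (Pid k : set (borel K)).
Proof. exact: measurable_borel_open. Qed.

Lemma haar_Pideal k : mu (Pid k) = (q%:R ^ (- k))%:E.
Proof. by rewrite -cball0 haar_cball. Qed.

(** Orthogonality of characters. If c annihilates P^k, the integrand is 1 there. Otherwise a shift
    by some y in P^k with chi (c y) != 1 multiplies the integral by that number, so it vanishes. *)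
Lemma cintegral_chi c k :
  cintegral (fun x => chi (c * x) * \1_(Pid k) x) = (q%:R ^ (- k))%:C%C * \1_(Pid (- k)) c.
Proof.
have [ck|ck] := pselect (Pid (- k) c).
  rewrite [in RHS]indicE mem_set// mulr1.
  rewrite (_ : (fun x => _) = (\1_(Pid k) : K -> R[i])).
    by rewrite cintegral_indic ?haar_Pideal//; exact: measurable_Pideal.
  apply/funext => x; rewrite indicE; case: (boolP (x \in Pid k)) => [|_]; last by rewrite mulr0.
  rewrite inE mulr1 => xk; apply: chi_integers.
  by have := PidealM ck xk; rewrite addNr.
rewrite [in RHS]indicE memNset// mulr0.
(* The witness is c^-1 times a point of P^(-1) where [chi] is not 1; [Pideal_gap] puts c^-1 into
   P^(1+k), so the product is in P^k. *)
have [y yk cy] : exists2 y, Pid k y & chi (c * y) != 1.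
  case: hchi => _ _ _ [y [y1 /eqP cy]]; exists (c^-1 * y).
    have := PidealM (Pideal_gap ck) y1.
    by rewrite opprK addrAC subrr add0r.
  rewrite mulVKf//; apply/eqP => c0; apply: ck; rewrite c0; exact: Pideal0.
pose F x := chi (c * x) * \1_(Pid k) x.
have mF : cmeasurable F.
  apply: cmeasurableM; first exact: cmeasurable_chi.
  by apply: cmeasurable_indic; exact: measurable_Pideal.
have iF : cintegrable F.
  apply: (@cintegrable_le _ _ _ _ (\1_(Pid k))) => //.
    by apply: cintegrable_indic; [exact: measurable_Pideal|rewrite haar_Pideal ltry].
  by move=> x; rewrite Normc.normcM normc_chi mul1r.
have : cintegral F = chi (c * y) * cintegral F.
  rewrite -cintegralZ// -(cintegral_translation y mF); congr cintegral.
  apply/funext => x; rewrite /F mulrDr chiD -mulrA; congr (_ * (_ * _)).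
  rewrite !indicE; congr (_%:R); congr nat_of_bool.
  apply/idP/idP; rewrite !inE => xk; last exact: PidealD.
  by rewrite -(addKr y x) addrC; exact: PidealB.
move/eqP; rewrite -subr_eq0 -{1}(mul1r (cintegral F)) -mulrBl mulf_eq0 subr_eq0.
by rewrite eq_sym (negbTE cy)/= => /eqP.
Qed.

(** [Pid (- m)] is Gamma^m. This is the transpose of cutting frequencies to Gamma^m, and
    transposition reverses the order, so the inverse transform is applied first. The operator is
    convolution with q^m times the indicator of P^m. *)
Definition lowpass (m : int) phi : K -> R[i] :=
  fourier mu chi (fun x => \1_(Pid (- m)) x * fourier_inv mu chi phi x).

Lemma cintegrable_chiM f c : cintegrable f -> cintegrable (fun x => f x * chi (c * x)).
Proof.
move=> fi; apply: (@cintegrableM_bounded _ _ _ _ _ 1) => //; first exact: cmeasurable_chi.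
by move=> x; rewrite normc_chi.
Qed.

Lemma cintegrable_cball k a : cintegrable (\1_(cb k a) : K -> R[i]).
Proof. by apply: cintegrable_indic; [exact: measurable_cball|rewrite haar_cball ltry]. Qed.
#[local] Hint Resolve cintegrable_cball : core.

Lemma cintegrable_test phi : test phi -> cintegrable phi.
Proof.
elim/test_function_ind: phi / => [||z f g _ _]; first exact: cintegrable0.
  exact: cintegrable_cball.
exact: cintegrable_lin.
Qed.

Lemma indic_ballD (A B : set K) x y : (A x <-> B y) -> \1_A x = \1_B y :> R[i].
Proof.
move=> AB; rewrite !indicE; congr (_%:R); congr nat_of_bool.
by apply/idP/idP; rewrite !inE => /AB.
Qed.

Lemma fourier_inv_cball k a :
  fourier_inv mu chi \1_(cb k a) =
  (fun x => (q%:R ^ (- k))%:C%C * (chi (x * a) * \1_(Pid (- k)) x)).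
Proof.
apply/funext => x; rewrite /fourier_inv.
rewrite -(cintegral_translation a); last first.
  by apply: cintegrable_measurable; apply: cintegrable_chiM; exact: cintegrable_cball.
rewrite mulrCA -cintegral_chi -cintegralZ.
  congr cintegral; apply/funext => y.
  rewrite mulrDr chiD mulrC mulrA; congr (_ * _); apply: indic_ballD.
  by rewrite cballP addrC addKr.
under eq_fun do rewrite mulrC; apply: cintegrable_chiM.
by apply: cintegrable_indic; [exact: measurable_Pideal|rewrite haar_Pideal ltry].
Qed.

Lemma fourier_chi_cball m a :
  fourier mu chi (fun x => chi (x * a) * \1_(Pid (- m)) x) =
  (fun xi => (q%:R ^ m)%:C%C * \1_(cb m a) xi).
Proof.
apply/funext => xi; rewrite /fourier.
rewrite (_ : (fun x => _) = (fun x => chi ((a - xi) * x) * \1_(Pid (- m)) x)).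
  rewrite cintegral_chi !opprK; congr (_ * _); apply: indic_ballD.
  by rewrite cballP; split=> /PidealN; rewrite opprB.
by apply/funext => x; rewrite chi_conj mulrAC -chiD mulrBl [a * x]mulrC.
Qed.

(** In frequency the cut-offs Gamma^m and Gamma^k meet in the smaller one. A ball finer than P^m is
    spread over its coset of P^m with its mass kept; a coarser one is unchanged. *)
Lemma lowpass_cball m k a : lowpass m \1_(cb k a) =
  (fun x => (q%:R ^ (Num.min m k - k))%:C%C * \1_(cb (Num.min m k) a) x).
Proof.
rewrite /lowpass fourier_inv_cball; apply/funext => xi.
set l := Num.min m k.
have -> : (fun x => \1_(Pid (- m)) x * ((q%:R ^ (- k))%:C%C * (chi (x * a) * \1_(Pid (- k)) x))) =
    (fun x => (q%:R ^ (- k))%:C%C * (chi (x * a) * \1_(Pid (- l)) x)) :> (K -> R[i]).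
  apply/funext => x; rewrite mulrCA; congr (_ * _); rewrite mulrCA; congr (_ * _).
  rewrite /l !indicE -natrM mulnb; congr (_%:R); congr nat_of_bool.
  apply/andP/idP; rewrite !inE; last move=> xl.
    by move=> [xm xk]; rewrite minElt; case: ifP.
  by split; apply: Pideal_le xl; rewrite lerN2 ge_min lexx ?orbT.
have := congr1 (fun F => F xi) (fourier_chi_cball l a); rewrite /fourier => e.
rewrite -[l - k]addrC /l expfzDr ?lt0r_neq0// rmorphM -mulrA -e -cintegralZ.
  by congr cintegral; apply/funext => x; rewrite !mulrA.
apply: (@cintegrableM_bounded _ _ _ _ _ 1).
- under eq_fun do rewrite mulrC [_ * a]mulrC; apply: cintegrable_chiM.
  by apply: cintegrable_indic; [exact: measurable_Pideal|rewrite haar_Pideal ltry].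
- under eq_fun do rewrite chi_conj -mulNr; exact: cmeasurable_chi.
- by move=> x; rewrite chi_conj normc_chi.
Qed.

Lemma fourier_inv_lin z f g : test f -> test g ->
  fourier_inv mu chi (fun x => z * f x + g x) =
  (fun x => z * fourier_inv mu chi f x + fourier_inv mu chi g x).
Proof.
move=> tf tg; apply/funext => x; rewrite /fourier_inv -cintegral_lin.
- by congr cintegral; apply/funext => y; rewrite mulrDl mulrA.
- by apply: cintegrable_chiM; exact: cintegrable_test.
- by apply: cintegrable_chiM; exact: cintegrable_test.
Qed.

Lemma cintegrable_lowpass m phi : test phi ->
  cintegrable (fun x => \1_(Pid (- m)) x * fourier_inv mu chi phi x).
Proof.
elim/test_function_ind: phi / => [|k a|z f g tf tg fi gi].
- rewrite (_ : (fun x => _) = fun=> 0); first exact: cintegrable0.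
  apply/funext => x; rewrite /fourier_inv; under [X in cintegral X]eq_fun do rewrite mul0r.
  by rewrite cintegral0 mulr0.
- rewrite fourier_inv_cball.
  under eq_fun do rewrite mulrC; apply: (@cintegrableM_bounded _ _ _ _ _ 1).
  + apply: cintegrableZ; under eq_fun do rewrite mulrC [_ * a]mulrC.
    apply: cintegrable_chiM.
    by apply: cintegrable_indic; [exact: measurable_Pideal|rewrite haar_Pideal ltry].
  + by apply: cmeasurable_indic; exact: measurable_Pideal.
  + by move=> x; rewrite indicE; case: (_ \in _); rewrite ?Normc.normc0 ?Normc.normc1.
- rewrite fourier_inv_lin//; under eq_fun do rewrite mulrDr mulrCA.
  exact: cintegrable_lin.
Qed.

Lemma lowpass_lin m z f g : test f -> test g ->
  lowpass m (fun x => z * f x + g x) = (fun x => z * lowpass m f x + lowpass m g x).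
Proof.
move=> tf tg; apply/funext => xi; rewrite /lowpass fourier_inv_lin// /fourier -cintegral_lin.
- by congr cintegral; apply/funext => x; rewrite mulrDr mulrDl mulrCA !mulrA.
- under eq_fun do rewrite chi_conj -mulNr; apply: cintegrable_chiM; exact: cintegrable_lowpass.
- under eq_fun do rewrite chi_conj -mulNr; apply: cintegrable_chiM; exact: cintegrable_lowpass.
Qed.

Lemma lowpass0 m : lowpass m (fun=> 0) = fun=> 0.
Proof.
have := lowpass_lin m (-1) (test_function0 abs q) (test_function0 abs q).
under [X in lowpass m X]eq_fun do rewrite mulr0 addr0.
by move=> ->; apply/funext => x; rewrite mulN1r addNr.
Qed.

Lemma test_lowpass m phi : test phi -> test (lowpass m phi).
Proof.
elim/test_function_ind: phi / => [|k a|z f g tf tg tlf tlg].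
- by rewrite lowpass0; exact: test_function0.
- rewrite lowpass_cball; have := test_function_lin (q%:R ^ (Num.min m k - k))%:C%C
    (test_function_cball abs q (Num.min m k) a) (test_function0 abs q).
  by under eq_fun do rewrite addr0.
- by rewrite (lowpass_lin m z tf tg); exact: test_function_lin.
Qed.

Lemma lowpassZ m z phi : test phi ->
  lowpass m (fun x => z * phi x) = (fun x => z * lowpass m phi x).
Proof.
move=> tphi; have := lowpass_lin m z tphi (test_function0 abs q).
rewrite lowpass0; under [X in lowpass m X]eq_fun do rewrite addr0.
by move=> ->; apply/funext => x; rewrite addr0.
Qed.

Lemma lowpass_lowpass m n phi : m <= n -> test phi -> lowpass n (lowpass m phi) = lowpass m phi.
Proof.
move=> mn; elim/test_function_ind: phi / => [|k a|z f g tf tg lf lg].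
- by rewrite !lowpass0.
- rewrite lowpass_cball lowpassZ; last exact: test_function_cball.
  rewrite lowpass_cball (_ : Num.min n _ = Num.min m k).
    by rewrite subrr expr0z; apply/funext => x; rewrite mul1r.
  by apply/min_idPr; rewrite ge_min mn.
- rewrite (lowpass_lin m z tf tg).
  rewrite (lowpass_lin n z (test_lowpass m tf) (test_lowpass m tg)).
  exact: (congr2 (fun (u v : K -> R[i]) x => z * u x + v x) lf lg).
Qed.

Lemma cball_scaling k j a x : cb k a (p ^ j * x) <-> cb (k - j) (p ^ (- j) * a) x.
Proof.
rewrite !cballP -{1}(subrK j k) [k - j + j]addrC.
have -> : p ^ j * x - a = p ^ j * (x - p ^ (- j) * a).
  by rewrite mulrBr mulrA -expfzDr// addrN expr0z mul1r.
exact: Pideal_scaling.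
Qed.

Lemma indic_cball_scaling k j a x :
  \1_(cb k a) (p ^ j * x) = \1_(cb (k - j) (p ^ (- j) * a)) x :> R[i].
Proof. by apply: indic_ballD; exact: cball_scaling. Qed.

Lemma test_scaling j phi : test phi -> test (fun x => phi (p ^ j * x)).
Proof.
elim/test_function_ind: phi / => [|k a|z f g tf tg tf' tg'].
- exact: test_function0.
- under eq_fun do rewrite indic_cball_scaling; exact: test_function_cball.
- exact: test_function_lin.
Qed.

(** Composition with x -> p^j x divides frequencies by q^j. By linearity only balls have to be
    checked, and for them both sides are explicit. *)
Lemma lowpass_scaling m j phi : test phi ->
  (fun x => lowpass m phi (p ^ j * x)) = lowpass (m - j) (fun x => phi (p ^ j * x)).
Proof.
elim/test_function_ind: phi / => [|k a|z f g tf tg lf lg].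
- by rewrite !lowpass0.
- under [X in lowpass (m - j) X]eq_fun do rewrite indic_cball_scaling.
  rewrite lowpass_cball; apply/funext => x; rewrite lowpass_cball.
  rewrite indic_cball_scaling.
  have -> : Num.min (m - j) (k - j) = Num.min m k - j by rewrite addr_minl.
  by congr ((_ ^ _)%:C%C * _); rewrite opprB addrA addrNK.
- rewrite (lowpass_lin m z tf tg).
  by rewrite (lowpass_lin (m - j) z (test_scaling j tf) (test_scaling j tg)) -lf -lg.
Qed.

(** * Averages over cosets as adjoints of low-pass operators *)

Definition average (m : int) h : K -> R[i] :=
  fun a => (q%:R ^ m)%:C%C * cintegral (fun x => h x * \1_(cb m a) x).

Lemma average_cball m h a b : cb m a b -> average m h a = average m h b.
Proof. by move=> ab; rewrite /average (cball_eq ab). Qed.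

Lemma cmeasurable_average m h : cmeasurable (average m h).
Proof.
apply: (locally_constant_cmeasurable (k := m)) => x y xy.
by apply/esym/average_cball/cballP.
Qed.

Lemma loc_integrable_cball h k a : loc_integrable mu h ->
  cintegrable (fun x => h x * \1_(cb k a) x).
Proof.
by move=> hh; apply: loc_integrable_indic => //; exact: cball_compact.
Qed.

Lemma loc_integrable_test h phi : loc_integrable mu h -> test phi ->
  cintegrable (fun x => h x * phi x).
Proof.
move=> hh; elim/test_function_ind: phi / => [|k a|z f g tf tg hf hg].
- by under eq_fun do rewrite mulr0; exact: cintegrable0.
- exact: loc_integrable_cball.
- by under eq_fun do rewrite mulrDr mulrCA; exact: cintegrable_lin.
Qed.

Lemma normc_real (c : R) : normc c%:C%C = `|c|.
Proof. by rewrite normc_sqrtE/= expr0n/= addr0 sqrtr_sqr. Qed.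

Lemma normc_average_le m h a : loc_integrable mu h ->
  ((normc (average m h a))%:E <=
    (2 * q%:R ^ m)%:E * \int[mu]_(x in cb m a) (normc (h x))%:E)%E.
Proof.
move=> hh; rewrite /average Normc.normcM normc_real ger0_norm ?exprz_ge0// EFinM.
rewrite mulrC EFinM -muleA; apply: lee_wpmul2l; first by rewrite lee_fin exprz_ge0.
rewrite -integral_normcM_indic; apply: normc_cintegral_le.
exact: loc_integrable_cball.
Qed.

Lemma bounded_loc_integrable h : cmeasurable h ->
  (forall n : nat, exists M : R, forall x, Pid (- n%:Z) x -> normc (h x) <= M) ->
  loc_integrable mu h.
Proof.
move=> [rh jh] hb; split=> // A cA.
have [n An] := compact_sub_Pideal cA.
have [M hM] := hb n.
have mA : measurable (A : set (borel K)) by exact: measurable_borel_compact.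
have muA : (mu A < +oo)%E by case: hmu => _ + _; exact.
apply: (@le_lt_trans _ _ (\int[mu]_(x in A) `|M|%:E)%E).
  apply: ge0_le_integral => //.
  - by move=> x _; rewrite lee_fin normc_ge0.
  - by apply/measurable_EFinP; apply: measurable_funTS; exact: measurable_normc.
  - by move=> x /An/hM xM; rewrite lee_fin (le_trans xM)// ler_norm.
by rewrite integral_cst// lte_mul_pinfty// lee_fin.
Qed.

Lemma loc_integrable_average m h : loc_integrable mu h -> loc_integrable mu (average m h).
Proof.
move=> hh; apply: bounded_loc_integrable; first exact: cmeasurable_average.
(* Each coset of P^m through a point of P^(-n) lies in P^k, so one integral of |h| bounds the
   average on all of P^(-n). *)
move=> n; pose k := Num.min m (- n%:Z).
have hk : (\int[mu]_(x in Pid k) (normc (h x))%:E < +oo)%E.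
  by case: hh => _ _; apply; exact: Pideal_compact.
exists (2 * q%:R ^ m * fine (\int[mu]_(x in Pid k) (normc (h x))%:E)%E) => x xn.
rewrite -lee_fin EFinM fineK; last first.
  by rewrite ge0_fin_numE//; apply: integral_ge0 => y _; rewrite lee_fin normc_ge0.
apply: le_trans (normc_average_le _ _ hh) _; apply: lee_wpmul2l.
  by rewrite lee_fin mulr_ge0 ?exprz_ge0.
apply: ge0_subset_integral => //.
- by apply: measurable_borel_open; exact: Pideal_open.
- by apply/measurable_EFinP; apply: measurable_funTS; apply: measurable_normc; case: hh.
- by move=> y _; rewrite lee_fin normc_ge0.
- move=> y /cballP yx; rewrite -(subrK x y).
  by apply: PidealD; [apply: Pideal_le yx|apply: Pideal_le xn];
    rewrite ge_min lexx ?orbT.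
Qed.

Lemma cintegral_average_cball m h a : loc_integrable mu h ->
  cintegral (fun x => average m h x * \1_(cb m a) x) = cintegral (fun x => h x * \1_(cb m a) x).
Proof.
move=> hh.
have -> : (fun x => average m h x * \1_(cb m a) x) = (fun x => average m h a * \1_(cb m a) x).
  apply/funext => x; rewrite indicE; case: (boolP (x \in cb m a)) => [|_]; last by rewrite !mulr0.
  by rewrite inE => /average_cball ->.
rewrite cintegralZ// cintegral_indic// haar_cball /= /average mulrC mulrA -rmorphM.
by rewrite -expfzDr ?lt0r_neq0// addNr expr0z mul1r.
Qed.

Lemma integral_Re_indic u A : measurable (A : set (borel K)) -> cintegrable u ->
  (\int[mu]_(x in A) (complex.Re (u x))%:E =
    (complex.Re (cintegral (fun x => (u x * \1_A x)%R)))%:E)%E.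
Proof.
move=> mA [iu _]; rewrite /cintegral /= /Rintegral.
have -> : (\int[mu]_x (complex.Re (u x * \1_A x)%R)%:E =
    \int[mu]_(x in A) (complex.Re (u x))%:E)%E.
  rewrite [RHS]integral_mkcond; apply: eq_integral => x _.
  by rewrite ReM_indic !patchE; case: ifP.
by rewrite fineK//; apply: integrable_fin_num => //; exact: integrableS iu.
Qed.

Lemma integral_Im_indic u A : measurable (A : set (borel K)) -> cintegrable u ->
  (\int[mu]_(x in A) (complex.Im (u x))%:E =
    (complex.Im (cintegral (fun x => (u x * \1_A x)%R)))%:E)%E.
Proof.
move=> mA [_ iu]; rewrite /cintegral /= /Rintegral.
have -> : (\int[mu]_x (complex.Im (u x * \1_A x)%R)%:E =
    \int[mu]_(x in A) (complex.Im (u x))%:E)%E.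
  rewrite [RHS]integral_mkcond; apply: eq_integral => x _.
  by rewrite ImM_indic !patchE; case: ifP.
by rewrite fineK//; apply: integrable_fin_num => //; exact: integrableS iu.
Qed.

Lemma eq_cintegral_cosets k u v : cintegrable u -> cintegrable v ->
  (forall a, cintegral (fun x => u x * \1_(cb k a) x) = cintegral (fun x => v x * \1_(cb k a) x)) ->
  cintegral u = cintegral v.
Proof.
move=> iu iv uv; rewrite /cintegral /Rintegral; congr (_ +i* _)%C; congr fine.
- apply: (eq_integral_cosets (k := k)); [by case: iu|by case: iv|].
  by move=> a; rewrite !integral_Re_indic ?uv.
- apply: (eq_integral_cosets (k := k)); [by case: iu|by case: iv|].
  by move=> a; rewrite !integral_Im_indic ?uv.
Qed.

Lemma cball_subset_disjoint k m a b : k <= m ->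
  cb m b `<=` cb k a \/ cb m b `&` cb k a = set0.
Proof.
move=> km; have [[x [xb xa]]|ne] := pselect (cb m b `&` cb k a !=set0); last first.
  by right; apply/eqP/negPn; apply/negP => /set0P.
left; rewrite (cball_eq xa) (cball_eq xb).
exact: cball_le.
Qed.

(** If m <= k, the average is constant on the ball and both sides are the same multiple of the
    integral of h over [cb m a]. If k < m, [lowpass m] fixes the indicator, the ball is a union of
    cosets of P^m, and h has the same integral over each of them as its average. *)
Lemma cintegral_average m h phi : loc_integrable mu h -> test phi ->
  cintegral (fun x => h x * lowpass m phi x) = cintegral (fun x => average m h x * phi x).
Proof.
move=> hh; elim/test_function_ind: phi / => [|k a|z f g tf tg hf hg]; first last.
- rewrite (lowpass_lin m z tf tg).
  have ha := loc_integrable_average m hh.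
  transitivity (z * cintegral (fun x => h x * lowpass m f x) +
      cintegral (fun x => h x * lowpass m g x)).
    rewrite -(cintegral_lin z (loc_integrable_test hh (test_lowpass m tf))
      (loc_integrable_test hh (test_lowpass m tg))).
    by congr cintegral; apply/funext => x; rewrite mulrDr mulrCA.
  transitivity (z * cintegral (fun x => average m h x * f x) +
      cintegral (fun x => average m h x * g x)).
    exact: (congr2 (fun u v => z * u + v) hf hg).
  rewrite -(cintegral_lin z (loc_integrable_test ha tf) (loc_integrable_test ha tg)).
  by congr cintegral; apply/funext => x; rewrite mulrDr mulrCA.
- rewrite lowpass_cball; have [mk|km] := leP m k.
    transitivity ((q%:R ^ (m - k))%:C%C * cintegral (fun x => h x * \1_(cb m a) x)).
      rewrite -cintegralZ; last exact: loc_integrable_cball.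
      by congr cintegral; apply/funext => x; rewrite mulrCA.
    have -> : (fun x => average m h x * \1_(cb k a) x) = (fun x => average m h a * \1_(cb k a) x).
      apply/funext => x; rewrite indicE.
      case: (boolP (x \in cb k a)) => [|_]; last by rewrite !mulr0.
      rewrite inE => xa; rewrite (@average_cball m h a x)//.
      exact: (cball_le mk xa).
    rewrite cintegralZ// cintegral_indic// haar_cball /= /average mulrAC -rmorphM.
    by rewrite -expfzDr ?lt0r_neq0.
  rewrite subrr expr0z; under eq_fun do rewrite mul1r.
  apply: (@eq_cintegral_cosets m).
  - exact: loc_integrable_cball.
  - by apply: loc_integrable_cball; exact: loc_integrable_average.
  - move=> b; have [sub|disj] := cball_subset_disjoint a b (ltW km).
      have e u : (fun x => u x * \1_(cb k a) x * \1_(cb m b) x) =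
          (fun x => u x * \1_(cb m b) x) :> (K -> R[i]).
        apply/funext => x; rewrite -mulrA !indicE; congr (_ * _).
        case: (boolP (x \in cb m b)) => [|_]; last by rewrite mulr0.
        by rewrite inE => /sub xa; rewrite mem_set// mulr1.
      by rewrite !e cintegral_average_cball.
    have e u : (fun x => u x * \1_(cb k a) x * \1_(cb m b) x) = (fun x => 0) :> (K -> R[i]).
      apply/funext => x; rewrite -mulrA !indicE.
      case: (boolP (x \in cb m b)) => [|_]; last by rewrite !mulr0.
      rewrite inE => xb; rewrite memNset ?mul0r ?mulr0// => xa.
      by have : (cb m b `&` cb k a) x by []; rewrite disj.
    by rewrite !e.
- rewrite lowpass0; by under eq_fun do rewrite mulr0; under [in RHS]eq_fun do rewrite mulr0.
Qed.

(** * Frequency pieces of a dilated distribution *)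

Lemma Gammaball_Pideal m : Gammaball abs q m = Pid (- m).
Proof. by rewrite /Gammaball /Pideal opprK. Qed.

Lemma Delta0E F phi : Delta 0 F phi = F (lowpass 0 phi).
Proof.
by rewrite /Delta /dfourier_inv /dmul /dfourier /shell Gammaball_Pideal.
Qed.

(** The indicator of a shell is the difference of those of two nested balls. The difference is
    written [- 1 * _ + _] to fit the shape [z * f + g] of the linearity lemmas. *)
Lemma DeltaSE (j : nat) F phi : test phi ->
  Delta j.+1 F phi = F (fun x => - 1 * lowpass j phi x + lowpass j.+1 phi x).
Proof.
move=> tphi; rewrite /Delta /dfourier_inv /dmul /dfourier; congr F.
apply/funext => xi; rewrite /lowpass /fourier.
have i1 n := cintegrable_chiM (- xi) (cintegrable_lowpass n tphi).
have e n : (fun x => \1_(Pid (- n)) x * fourier_inv mu chi phi x * (chi (xi * x))^*%C) =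
    (fun x => \1_(Pid (- n)) x * fourier_inv mu chi phi x * chi (- xi * x)).
  by apply/funext => x; rewrite chi_conj mulNr.
rewrite !e -(cintegral_lin (-1) (i1 j) (i1 j.+1)); congr cintegral; apply/funext => x.
rewrite chi_conj !mulrA -mulNr -!mulrDl; congr (_ * _ * _).
rewrite mulN1r /shell !Gammaball_Pideal !indicE.
have [xj|xj] := pselect (Pid (- j%:Z) x).
  rewrite (mem_set xj) memNset ?mem_set ?addNr//; last by move=> [].
  by apply: Pideal_le xj; rewrite lerN2 lez_nat.
rewrite (memNset xj) oppr0 add0r; congr (_%:R); congr nat_of_bool.
by apply/idP/idP; rewrite !inE; [case|split].
Qed.

Lemma distribution_lin F z f g : is_distribution abs q F -> test f -> test g ->
  F (fun x => z * f x + g x) = z * F f + F g.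
Proof. by move=> [h _] tf tg; exact: h. Qed.

Lemma loc_integrable_scaling a h : a != 0 -> loc_integrable mu h ->
  loc_integrable mu (fun x => h (a * x)).
Proof.
move=> a0 [rh jh ih].
have [ra ja] : cmeasurable (fun x => h (a * x)).
  by apply: (cmeasurable_comp (continuous_borel_measurable (@continuous_scaling _ a))).
split=> // A cA.
have cB : compact [set a * x | x in A].
  by apply: continuous_compact => //; apply: continuous_subspaceT; exact: continuous_scaling.
rewrite -integral_normcM_indic.
have -> : (\int[mu]_x (normc (h (a * x) * \1_A x)%R)%:E =
    (abs a)^-1%:E * \int[mu]_x (normc (h x * \1_[set a * x | x in A] x)%R)%:E)%E.
  rewrite -(integral_scaling a0).
    apply: eq_integral => x _; congr (normc (_ * _))%:E; apply: indic_ballD.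
    by split=> [xA|[y yA /(mulfI a0) <-//]]; exists x.
  apply/measurable_EFinP; apply: measurable_normc; apply: cmeasurableM => //.
  by apply: cmeasurable_indic; exact: measurable_borel_compact.
rewrite integral_normcM_indic lte_mul_pinfty ?lee_fin ?invr_ge0//.
exact: ih.
Qed.

Lemma represents_scaling (k : nat) h (G : functional R K) : loc_integrable mu h ->
  (forall phi, test phi ->
    G phi = (q%:R ^+ k)^-1 * cintegral (fun x => h x * phi (p ^+ k * x))) ->
  represents (fun x => h (p ^- k * x)) G.
Proof.
move=> hh Gh; have pk0 : p ^+ k != 0 by rewrite expf_neq0.
have hs : loc_integrable mu (fun x => h (p ^- k * x)).
  by apply: loc_integrable_scaling => //; rewrite invr_neq0.
split=> // phi tphi; rewrite Gh//.
have mf : cmeasurable (fun x => h x * phi (p ^+ k * x)).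
  apply: cintegrable_measurable; apply: loc_integrable_test => //.
  by have := test_scaling k tphi.
have := cintegral_scaling (invr_neq0 pk0) mf.
rewrite absV invrK absX abs_prime exprVn.
have -> : ((q%:R ^+ k)^-1)%:C%C = (q%:R ^+ k)^-1 :> R[i].
  by rewrite fmorphV rmorphXn/= rmorph_nat.
move=> <-; congr cintegral; apply/funext => x.
by rewrite mulrA divff// mul1r.
Qed.

Lemma Delta_dilation_high (j k : nat) F h : represents h (Delta j.+1 F) ->
  represents (fun x => h (p ^- k * x)) (Delta (j.+1 + k) (dilation k F)).
Proof.
move=> [hh hF]; apply: represents_scaling => // phi tphi.
rewrite addSn DeltaSE// /dilation -hF; last by have := test_scaling k tphi.
rewrite DeltaSE; last by have := test_scaling k tphi.
congr (_ * F _); apply/funext => x.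
have e n : lowpass (n + k)%N phi (p ^+ k * x) = lowpass n (fun x => phi (p ^+ k * x)) x.
  have := congr1 (fun u => u x) (lowpass_scaling (n + k)%N k tphi).
  by rewrite PoszD addrK.
by rewrite e -addSn e.
Qed.

Definition lowpart (k i : nat) h : K -> R[i] :=
  if i is j.+1 then fun x => - 1 * average (j%:Z - k%:Z) h x + average (j.+1%:Z - k%:Z) h x
  else average (- k%:Z) h.

Lemma loc_integrable_lin z f g : loc_integrable mu f -> loc_integrable mu g ->
  loc_integrable mu (fun x => z * f x + g x).
Proof.
move=> hf hg; have [rm jm] : cmeasurable (fun x => z * f x + g x).
  apply: cmeasurableD; last by case: hg.
  by apply: cmeasurableM; [exact: cmeasurable_cst|case: hf].
split=> // A cA; rewrite -integral_normcM_indic.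
have mA : measurable (A : set (borel K)) by exact: measurable_borel_compact.
have := cintegrable_lin z (loc_integrable_indic hf cA mA) (loc_integrable_indic hg cA mA).
by under eq_fun do rewrite mulrA -mulrDl; move=> /cintegrable_normc[].
Qed.

Lemma Delta_dilation_low (k i : nat) F h : (i <= k)%N -> is_distribution abs q F ->
  represents h (Delta 0 F) ->
  represents (fun x => lowpart k i h (p ^- k * x)) (Delta i (dilation k F)).
Proof.
move=> ik dF [hh hF].
(* As m - k <= 0, [lowpass 0], which defines [Delta 0], can be inserted without effect. Then F is
   seen only through h, and adjointness trades the low-pass operator for an average of h. *)
have low (m l : int) phi : l = m - k%:Z -> m <= k%:Z -> test phi ->
    F (fun x => lowpass m phi (p ^+ k * x)) =
    cintegral (fun x => average l h x * phi (p ^+ k * x)).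
  move=> -> mk tphi; have ts := test_scaling k tphi.
  have := lowpass_scaling m k tphi; rewrite -exprnP => ->.
  rewrite -(cintegral_average (m - k%:Z) hh ts) -hF; last exact: test_lowpass.
  by rewrite Delta0E lowpass_lowpass// subr_le0.
have la := loc_integrable_average.
apply: represents_scaling.
  by case: i ik => [|j] ik; [exact: la|apply: loc_integrable_lin; exact: la].
move=> phi tphi; have ts := test_scaling k tphi.
case: i ik => [|j] ik.
  have k0 : (0 : int) <= k%:Z by [].
  by rewrite Delta0E /dilation (low 0 (- k%:Z) phi (esym (sub0r _)) k0 tphi).
rewrite (DeltaSE j _ tphi) /dilation; congr (_ * _).
have tl m := test_scaling k (test_lowpass m tphi).
rewrite (distribution_lin (-1) dF (tl j) (tl j.+1)).
have jk : j%:Z <= k%:Z by rewrite lez_nat ltnW.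
have jk1 : j.+1%:Z <= k%:Z by rewrite lez_nat.
rewrite (low j _ phi erefl jk tphi) (low j.+1 _ phi erefl jk1 tphi).
rewrite -(cintegral_lin (-1) (loc_integrable_test (la (j%:Z - k%:Z) h hh) ts)
  (loc_integrable_test (la (j.+1%:Z - k%:Z) h hh) ts)).
by congr cintegral; apply/funext => x; rewrite mulrDl mulrA.
Qed.

Lemma aeS (S1 S2 : K -> Prop) : (forall x, S1 x -> S2 x) ->
  (\forall x \ae mu, S1 x) -> \forall x \ae mu, S2 x.
Proof. by move=> S12; apply: (@filterS _ _ (ae_filter_ringOfSetsType mu)). Qed.

Lemma aeS2 (S1 S2 S3 : K -> Prop) : (forall x, S1 x -> S2 x -> S3 x) ->
  (\forall x \ae mu, S1 x) -> (\forall x \ae mu, S2 x) -> \forall x \ae mu, S3 x.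
Proof. by move=> S123; apply: (@filterS2 _ _ (ae_filter_ringOfSetsType mu)). Qed.

Lemma loc_integrable_cmeasurable h : loc_integrable mu h -> cmeasurable h.
Proof. by case. Qed.

Lemma integral_patch (g v : K -> R) A : measurable (A : set (borel K)) ->
  (forall x, v x = (g \_ A) x) -> mu.-integrable [set: borel K] (fun x => (v x)%:E) ->
  mu.-integrable (A : set (borel K)) (fun x => (g x)%:E) /\
  (\int[mu]_(x in A) (g x)%:E = (\int[mu]_x v x)%:E)%E.
Proof.
move=> mA vg iv.
have e : (fun x => (g x)%:E) \_ A = (fun x => (v x)%:E).
  by apply/funext => x; rewrite vg !patchE; case: ifP.
split; first by apply/integrable_mkcond; rewrite ?e.
by rewrite integral_mkcond e /Rintegral fineK//; exact: (integrable_fin_num measurableT iv).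
Qed.

Lemma cintegral_test0_ae h : loc_integrable mu h ->
  (forall phi, test phi -> cintegral (fun x => h x * phi x) = 0) ->
  \forall x \ae mu, h x = 0.
Proof.
move=> hh h0; have [mr mi] := loc_integrable_cmeasurable hh.
have Re0 : \forall x \ae mu, complex.Re (h x) = 0.
  have pr k a := integral_patch (measurable_cball k a)
    (ReM_indic h (cb k a)) (loc_integrable_cball k a hh).1.
  apply: (cballs_integral0_ae (w := fun x => complex.Re (h x))) => //.
    by move=> k a; have [] := pr k a.
  move=> k a; have [_ ->] := pr k a.
  by have := congr1 (@complex.Re R) (h0 _ (test_function_cball abs q k a)) => /= ->.
have Im0 : \forall x \ae mu, complex.Im (h x) = 0.
  have pr k a := integral_patch (measurable_cball k a)
    (ImM_indic h (cb k a)) (loc_integrable_cball k a hh).2.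
  apply: (cballs_integral0_ae (w := fun x => complex.Im (h x))) => //.
    by move=> k a; have [] := pr k a.
  move=> k a; have [_ ->] := pr k a.
  by have := congr1 (@complex.Im R) (h0 _ (test_function_cball abs q k a)) => /= ->.
apply: aeS2 Re0 Im0 => x rx ix.
by apply/eqP; rewrite eq_complex rx ix /= !eqxx.
Qed.

(** Since [lowpass 0] is idempotent, h and its average pair equally with every test function, and
    test functions separate locally integrable functions up to null sets. *)
Lemma represents_Delta0_average F h : represents h (Delta 0 F) ->
  \forall x \ae mu, h x = average 0 h x.
Proof.
move=> [hh hF]; have ha := loc_integrable_average 0 hh.
suff : \forall x \ae mu, -1 * h x + average 0 h x = 0.
  apply: aeS => x; rewrite mulN1r addrC => /eqP; rewrite subr_eq0.
  by move=> /eqP ->.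
apply: cintegral_test0_ae; first exact: loc_integrable_lin hh ha.
move=> phi tphi; have tl := test_lowpass 0 tphi.
transitivity (-1 * cintegral (fun x => h x * phi x) + cintegral (fun x => average 0 h x * phi x)).
  rewrite -(cintegral_lin (-1) (loc_integrable_test hh tphi) (loc_integrable_test ha tphi)).
  by congr cintegral; apply/funext => x; rewrite mulrDl mulrA.
rewrite -(cintegral_average 0 hh tphi) -(hF _ tphi) -(hF _ tl) !Delta0E.
by rewrite (lowpass_lowpass (lexx 0) tphi) mulN1r addNr.
Qed.

(** * Norm estimates *)

Lemma Q_gt0 (n : nat) : 0 < Q n.
Proof. by rewrite exprn_gt0. Qed.
#[local] Hint Resolve Q_gt0 : core.

Lemma measurable_normc_powR h (r : R) (A : set K) : cmeasurable h ->
  measurable_fun (A : set (borel K)) (fun x : borel K => (normc (h x) `^ r)%:E).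
Proof.
move=> mh; apply: measurable_funTS; apply/measurable_EFinP.
exact: (measurableT_comp (@measurable_powR R r) (measurable_normc mh)).
Qed.

Lemma haar_cballN (n : nat) a : mu (cb (- n%:Z) a) = (Q n)%:E.
Proof. by rewrite haar_cball opprK. Qed.

(** For r < 1, h is replaced by its average over cosets of D, which equals it almost everywhere.
    Being constant on cosets of measure 1, the r-th power at a point is its integral over such a
    coset, hence at most that over the ball; this is the hypothesis of [subadditive_power_mean]. *)
Lemma cball_integral_powR F h (r : R) (n : nat) a : 0 < r -> represents h (Delta 0 F) ->
  ((\int[mu]_(x in cb (- n%:Z) a) (normc (h x))%:E) `^ r <=
   (Q n `^ Num.max (r - 1) 0)%:E * \int[mu]_(x in cb (- n%:Z) a) (normc (h x) `^ r)%:E)%E.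
Proof.
move=> r0 rep; have [hh _] := rep; have mh := loc_integrable_cmeasurable hh.
have mB := measurable_cball (- n%:Z) a.
have [r1|r1] := leP 1 r.
  rewrite max_l ?subr_ge0//; apply: hoelder_set => //.
  - exact: measurable_normc.
  - by move=> x; exact: normc_ge0.
  - exact: haar_cballN.
rewrite max_r ?subr_le0 ?(ltW r1)// powRr0 mul1e.
have mav := cmeasurable_average 0 h.
have eq := represents_Delta0_average rep.
have -> : (\int[mu]_(x in cb (- n%:Z) a) (normc (h x))%:E =
    \int[mu]_(x in cb (- n%:Z) a) (normc (average 0 h x))%:E)%E.
  apply: ae_eq_integral => //.
  - by apply: measurable_funTS; apply/measurable_EFinP; exact: measurable_normc.
  - by apply: measurable_funTS; apply/measurable_EFinP; exact: measurable_normc.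
  - by apply: aeS eq => x ->.
have -> : (\int[mu]_(x in cb (- n%:Z) a) (normc (h x) `^ r)%:E =
    \int[mu]_(x in cb (- n%:Z) a) (normc (average 0 h x) `^ r)%:E)%E.
  apply: ae_eq_integral => //.
  - exact: measurable_normc_powR.
  - exact: measurable_normc_powR.
  - by apply: aeS eq => x ->.
apply: subadditive_power_mean => //.
- exact: measurable_normc.
- by move=> x; exact: normc_ge0.
move=> x Bx.
have sub : cb 0 x `<=` cb (- n%:Z) a.
  rewrite (cball_eq Bx); apply: cball_le.
  by rewrite oppr_le0.
apply: (@le_trans _ _ (\int[mu]_(y in cb 0 x) (normc (average 0 h y) `^ r)%:E)%E).
  rewrite (_ : (\int[mu]_(y in cb 0 x) _ =
      \int[mu]_(y in cb 0 x) (normc (average 0 h x) `^ r)%:E)%E).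
    by rewrite integral_cst ?haar_cball ?oppr0 ?expr0z ?mule1//; exact: measurable_cball.
  apply: eq_integral => y; rewrite inE => xy.
  by rewrite -(average_cball _ xy).
apply: ge0_subset_integral => //; first exact: measurable_normc_powR.
by move=> y _; rewrite lee_fin powR_ge0.
Qed.

(** The factors on the left are the normalisation of the average, the power-mean constant and the
    measure of the ball. Exponents of q^n: - c + max (c - 1, 0) + 1 = max (1 - c, 0). *)
Lemma average_constantE (n : nat) (c : R) : (2 * (Q n)^-1) `^ c * Q n `^ Num.max (c - 1) 0 * Q n =
  2 `^ c * Q n `^ Num.max (1 - c) 0.
Proof.
have Q0 := Q_gt0 n; have Qn : Q n != 0 by exact: lt0r_neq0.
rewrite powRM ?invr_ge0 ?ltW// -!mulrA; congr (_ * _).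
rewrite -{1}(powR_inv1 (ltW Q0)) -powRrM mulN1r -{3}(powRr1 (ltW Q0)).
have QD (x y : R) : Q n `^ x * Q n `^ y = Q n `^ (x + y).
  by rewrite powRD//; apply/implyP.
rewrite !QD; congr (_ `^ _).
by have [h|h] := leP (c - 1) 0; have [g|g] := leP (1 - c) 0; lra.
Qed.

Lemma integral_average_powR F h (r : R) (n : nat) : 0 < r -> represents h (Delta 0 F) ->
  (\int[mu]_x (normc (average (- n%:Z) h x) `^ r)%:E <=
   (2 `^ r * Q n `^ Num.max (1 - r) 0)%:E * \int[mu]_x (normc (h x) `^ r)%:E)%E.
Proof.
move=> r0 rep; have [hh _] := rep; have mh := loc_integrable_cmeasurable hh.
have ma := cmeasurable_average (- n%:Z) h.
pose c := 2 `^ r * Q n `^ Num.max (1 - r) 0.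
have c0 : 0 <= c by rewrite mulr_ge0 ?powR_ge0.
have mhr (A : set K) := @measurable_normc_powR h r A mh.
have hr0 x : (0 <= (normc (h x) `^ r)%:E)%E by rewrite lee_fin powR_ge0.
rewrite -/c -ge0_integralZl//.
apply: (ge0_le_integral_cosets (k := - n%:Z)).
- exact: measurable_normc_powR.
- exact: (measurable_funeM c%:E (mhr setT)).
- by move=> x; rewrite lee_fin powR_ge0.
- by move=> x; apply: mule_ge0.
move=> a; have mB := measurable_cball (- n%:Z) a.
rewrite ge0_integralZl//.
have -> : (\int[mu]_(x in cb (- n%:Z) a) (normc (average (- n%:Z) h x) `^ r)%:E =
    (normc (average (- n%:Z) h a) `^ r)%:E * (Q n)%:E)%E.
  pose z0 := (normc (average (- n%:Z) h a) `^ r)%:E.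
  transitivity (\int[mu]_(x in cb (- n%:Z) a) z0)%E; last first.
    by rewrite integral_cst// (haar_cballN n a).
  by apply: eq_integral => x; rewrite inE => xa; rewrite /z0 (average_cball _ xa).
have le1 : ((normc (average (- n%:Z) h a) `^ r)%:E <=
    ((2 * (Q n)^-1) `^ r * Q n `^ Num.max (r - 1) 0)%:E *
      \int[mu]_(x in cb (- n%:Z) a) (normc (h x) `^ r)%:E)%E.
  have U0 : (0 <= \int[mu]_(x in cb (- n%:Z) a) (normc (h x))%:E)%E.
    by apply: integral_ge0 => x _; rewrite lee_fin normc_ge0.
  have := normc_average_le (- n%:Z) a hh.
  have -> : q%:R ^ (- n%:Z) = (Q n)^-1 by rewrite -exprnN.
  move=> /(poweR_le (ltW r0)); rewrite lee_fin normc_ge0 => /(_ isT).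
  have q2 : (0 <= (2 * (Q n)^-1)%:E)%E.
    by rewrite lee_fin mulr_ge0// invr_ge0; exact: ltW (Q_gt0 n).
  rewrite (poweRM r q2 U0).
  move=> /le_trans; apply; rewrite [X in (_ <= X * _)%E]EFinM -muleA; apply: lee_wpmul2l.
    by rewrite lee_fin powR_ge0.
  exact: cball_integral_powR rep.
apply: (@le_trans _ _ (((2 * (Q n)^-1) `^ r * Q n `^ Num.max (r - 1) 0)%:E *
      \int[mu]_(x in cb (- n%:Z) a) (normc (h x) `^ r)%:E * (Q n)%:E)%E).
  by apply: lee_wpmul2r => //; rewrite lee_fin ltW.
by rewrite muleAC -EFinM average_constantE.
Qed.

Lemma normc_linN_le (z1 z2 : R[i]) : normc (- 1 * z1 + z2) <= normc z1 + normc z2.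
Proof.
apply: le_trans (@le_normcD R (- 1 * z1) z2) _; rewrite lerD2r mulN1r.
by rewrite (@normcN R z1).
Qed.

(** As x + y <= 2 max (x, y), this quasi-triangle inequality covers r < 1 and r >= 1 alike. *)
Lemma powRD_le (x y r : R) : 0 <= x -> 0 <= y -> 0 < r ->
  (x + y) `^ r <= 2 `^ r * (x `^ r + y `^ r).
Proof.
move=> x0 y0 r0; rewrite mulrDr -!powRM//.
wlog xy : x y x0 y0 / x <= y => [H|].
  have [xy|/ltW yx] := leP x y; first exact: H.
  by rewrite (addrC x) (addrC (_ `^ _)); exact: H.
apply: (@le_trans _ _ ((2 * y) `^ r)); last by rewrite lerDr powR_ge0.
by apply: ge0_ler_powR; rewrite ?nnegrE ?addr_ge0 ?mulr_ge0 ?(ltW r0)//; lra.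
Qed.

Lemma powRQ_le (n1 n2 : nat) (c : R) : (n1 <= n2)%N -> 0 <= c -> Q n1 `^ c <= Q n2 `^ c.
Proof.
move=> n12 c0; apply: ge0_ler_powR; rewrite ?nnegrE ?(ltW (Q_gt0 _))//.
by rewrite ler_weXn2l// ltW.
Qed.

Lemma subzn_opp (k j : nat) : (j <= k)%N -> j%:Z - k%:Z = - (k - j)%N%:Z.
Proof. by move=> jk; rewrite -subzn// opprB. Qed.

(** The constant collects 2^r from [powRD_le], 2^r from [integral_average_powR] and 2 for the two
    averages. The coarser one, over cosets of P^(i-1-k), gives the exponent k + 1 - i; at i = 0 only
    k occurs, and the slack keeps the formula uniform. *)
Lemma integral_lowpart_powR F h (r : R) (k i : nat) : 0 < r -> (i <= k)%N ->
  represents h (Delta 0 F) ->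
  (\int[mu]_x (normc (lowpart k i h x) `^ r)%:E <=
   (2 * (2 `^ r * 2 `^ r) * Q (k.+1 - i) `^ Num.max (1 - r) 0)%:E *
     \int[mu]_x (normc (h x) `^ r)%:E)%E.
Proof.
move=> r0 ik rep; pose s := Num.max (1 - r) 0; rewrite -/s.
have s0 : 0 <= s by rewrite /s le_max lexx orbT.
have J0 : (0 <= \int[mu]_x (normc (h x) `^ r)%:E)%E.
  by apply: integral_ge0 => x _; rewrite lee_fin powR_ge0.
have r21 : 1 <= 2 `^ r by rewrite -[leLHS](powRr0 2) ler_powR// ?ler1n// ltW.
have r20 : 0 <= 2 `^ r :> R by exact: powR_ge0.
have av n : (n <= k.+1 - i)%N -> (\int[mu]_x (normc (average (- n%:Z) h x) `^ r)%:E <=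
    (2 `^ r * Q (k.+1 - i) `^ s)%:E * \int[mu]_x (normc (h x) `^ r)%:E)%E.
  move=> nk; apply: le_trans (integral_average_powR n r0 rep) _.
  by apply: lee_wpmul2r => //; rewrite lee_fin ler_wpM2l// powRQ_le.
have c2 : 2 `^ r * Q (k.+1 - i) `^ s <= 2 * (2 `^ r * 2 `^ r) * Q (k.+1 - i) `^ s.
  rewrite ler_wpM2r ?powR_ge0// mulrA ler_peMl//.
  by lra.
case: i ik av c2 => [|i] ik av c2.
  apply: le_trans (av k _) _; first by rewrite subn0.
  by apply: lee_wpmul2r => //; rewrite lee_fin.
have ik' : (i <= k)%N by exact: ltnW.
have e1 : i%:Z - k%:Z = - (k - i)%N%:Z by exact: subzn_opp.
have e2 : i.+1%:Z - k%:Z = - (k - i.+1)%N%:Z by exact: subzn_opp.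
have m1 := @measurable_normc_powR _ r setT (cmeasurable_average (- (k - i)%N%:Z) h).
have m2 := @measurable_normc_powR _ r setT (cmeasurable_average (- (k - i.+1)%N%:Z) h).
apply: (@le_trans _ _ (\int[mu]_x ((2 `^ r)%:E *
    ((normc (average (- (k - i)%N%:Z) h x) `^ r)%:E +
     (normc (average (- (k - i.+1)%N%:Z) h x) `^ r)%:E)))%E).
  apply: ge0_le_integral; first exact: measurableT.
  - by move=> x _; rewrite lee_fin powR_ge0.
  - apply: (@measurable_normc_powR _ r setT); rewrite /lowpart.
    apply: cmeasurableD; last exact: cmeasurable_average.
    apply: cmeasurableM; [exact: cmeasurable_cst|exact: cmeasurable_average].
  - exact: (measurable_funeM (2 `^ r)%:E (emeasurable_funD m1 m2)).
  - move=> x _; rewrite -EFinD -EFinM lee_fin /lowpart e1 e2.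
    apply: le_trans (powRD_le (normc_ge0 _) (normc_ge0 _) r0).
    apply: ge0_ler_powR; rewrite ?nnegrE ?addr_ge0 ?normc_ge0 ?(ltW r0)//.
    exact: normc_linN_le.
have A0 z : (0 <= (normc z `^ r)%:E)%E by rewrite lee_fin powR_ge0.
have AA0 (z1 z2 : R[i]) : (0 <= (normc z1 `^ r)%:E + (normc z2 `^ r)%:E)%E.
  exact: adde_ge0.
have r20E : (0 <= (2 `^ r)%:E)%E by rewrite lee_fin.
rewrite (ge0_integralZl mu measurableT (emeasurable_funD m1 m2) (fun x _ => AA0 _ _) r20E).
rewrite (ge0_integralD mu measurableT (fun x _ => A0 _) m1 (fun x _ => A0 _) m2).
have d0 : (0 <= (2 `^ r * Q (k.+1 - i.+1) `^ s)%:E)%E.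
  by rewrite lee_fin mulr_ge0 ?powR_ge0.
apply: (@le_trans _ _ ((2 `^ r)%:E *
    ((2 `^ r * Q (k.+1 - i.+1) `^ s)%:E * \int[mu]_x (normc (h x) `^ r)%:E +
     (2 `^ r * Q (k.+1 - i.+1) `^ s)%:E * \int[mu]_x (normc (h x) `^ r)%:E)))%E.
  apply: lee_wpmul2l; first exact: r20E.
  by apply: leeD; apply: av; rewrite subSS// leq_sub2l.
rewrite -(ge0_muleDl _ d0 d0) muleA -EFinD -EFinM.
apply: lee_wpmul2r; first exact: J0.
by rewrite lee_fin; lra.
Qed.

Lemma Lnorm_normcE (r : R) f : Lnorm mu r%:E (fun x : borel K => (normc (f x))%:E) =
  ((\int[mu]_x (normc (f x) `^ r)%:E) `^ r^-1)%E.
Proof.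
rewrite unlock /Lnorm; congr (_ `^ _)%E; apply: eq_integral => x _.
by rewrite /= ger0_norm ?normc_ge0.
Qed.

(** At exponent +oo, [Lnorm] is an essential supremum only on a space of positive measure. *)
Lemma haar_setT_gt0 : (0 < mu setT)%E.
Proof. by case: hmu => _ _; apply; [exact: openT|exists 0]. Qed.

Lemma Lnormy_leP f (y : \bar R) :
  (Lnorm mu +oo%E (fun x : borel K => (normc (f x))%:E) <= y)%E <->
  \forall x \ae mu, ((normc (f x))%:E <= y)%E.
Proof.
rewrite unlock /Lnorm haar_setT_gt0; split.
  move=> /ess_supP; apply: aeS => x /=.
  by rewrite ger0_norm ?normc_ge0.
move=> h; apply/ess_supP; move: h; apply: aeS => x /=.
by rewrite ger0_norm ?normc_ge0.
Qed.

Lemma rinv_EFin (r : R) : 0 < r -> rinv r%:E = r^-1.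
Proof. by move=> r0; rewrite /rinv inver gt_eqF. Qed.

Lemma rinvy : rinv (+oo%E : \bar R) = 0.
Proof. by rewrite /rinv invey. Qed.

(** In this form [sigma_r] is the exponent left by taking the r-th root of the factor q^(n max (1 -
    r, 0)) of [integral_average_powR]. *)
Lemma sigma_r_EFin (r : R) : 0 < r -> sigma_r r%:E = Num.max (1 - r) 0 * r^-1.
Proof.
move=> r0; rewrite /sigma_r rinv_EFin// maxr_pMl ?invr_ge0 ?(ltW r0)// mul0r mulrBl.
by rewrite mul1r divff// lt0r_neq0.
Qed.

Lemma sigma_ry : sigma_r (+oo%E : \bar R) = 0.
Proof. by rewrite /sigma_r rinvy sub0r max_r// oppr_le0. Qed.

Lemma normc_average_le_sup h (y : R) (n : nat) a : loc_integrable mu h ->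
  (\forall x \ae mu, normc (h x) <= y) -> 0 <= y -> normc (average (- n%:Z) h a) <= 2 * y.
Proof.
move=> hh hy y0; have mh := loc_integrable_cmeasurable hh.
have mB := measurable_cball (- n%:Z) a.
rewrite -lee_fin; apply: le_trans (normc_average_le (- n%:Z) a hh) _.
have -> : q%:R ^ (- n%:Z) = (Q n)^-1 by rewrite -exprnN.
have Qn0 := Q_gt0 n.
apply: (@le_trans _ _ ((2 * (Q n)^-1)%:E * (y%:E * (Q n)%:E))%E).
  apply: lee_wpmul2l; first by rewrite lee_fin mulr_ge0// invr_ge0 ltW.
  rewrite -(haar_cballN n a) -(integral_cst mu mB).
  apply: (ae_ge0_le_integral mB).
  - by move=> x _; rewrite lee_fin normc_ge0.
  - by apply: measurable_funTS; apply/measurable_EFinP; exact: measurable_normc.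
  - by move=> x _; rewrite lee_fin.
  - exact: measurable_cst.
  - by apply: aeS hy => x hx _; rewrite lee_fin.
rewrite -!EFinM lee_fin -mulrA ler_pM2l// mulrCA mulVf ?mulr1//.
exact: lt0r_neq0.
Qed.

Lemma Lnorm_lowpart (r : \bar R) : (0 < r)%E -> exists2 C : R, 0 < C &
  forall F h (k i : nat), (i <= k)%N -> represents h (Delta 0 F) ->
  (Ln r (lowpart k i h) <= (C * Q (k.+1 - i) `^ sigma_r r)%:E * Ln r h)%E.
Proof.
case: r => [r| |//] r0.
  rewrite lte_fin in r0; pose D : R := 2 * (2 `^ r * 2 `^ r).
  have D0 : 0 < D by rewrite !mulr_gt0 ?powR_gt0.
  exists (D `^ r^-1); first by rewrite powR_gt0.
  move=> F h k i ik rep; rewrite !Lnorm_normcE.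
  have J0 : (0 <= \int[mu]_x (normc (h x) `^ r)%:E)%E.
    by apply: integral_ge0 => x _; rewrite lee_fin powR_ge0.
  have := integral_lowpart_powR r0 ik rep.
  have ri0 : 0 <= r^-1 by rewrite invr_ge0 ltW.
  move=> /(poweR_le ri0) h1; apply: le_trans (h1 _) _.
    by apply: integral_ge0 => x _; rewrite lee_fin powR_ge0.
  rewrite poweRM ?lee_fin ?mulr_ge0 ?powR_ge0//; apply: lee_wpmul2r; first exact: poweR_ge0.
  rewrite poweR_EFin lee_fin powRM ?powR_ge0 ?(ltW D0)// -powRrM.
  by rewrite sigma_r_EFin.
(* For r = +oo each average costs 2 by [normc_average_le_sup], and a difference involves two of
   them. *)
exists 4 => // F h k i ik rep; rewrite sigma_ry powRr0 mulr1.
have [hh _] := rep.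
have N0 : (0 <= Ln +oo%E h)%E by exact: Lnorm_ge0.
case E : (Ln +oo%E h) N0 => [y||//] y0; last first.
  by rewrite gt0_muley ?leey// lte_fin.
rewrite lee_fin in y0.
have hy : \forall x \ae mu, normc (h x) <= y.
  have /Lnormy_leP : (Ln +oo%E h <= y%:E)%E by rewrite E.
  by apply: aeS => x; rewrite lee_fin.
have av n x : normc (average (- n%:Z) h x) <= 2 * y by exact: normc_average_le_sup.
apply/Lnormy_leP; apply: aeS hy => x _; rewrite -EFinM lee_fin /lowpart.
case: i ik => [|i] ik.
  by apply: le_trans (av k x) _; rewrite ler_wpM2r// ler_nat.
rewrite (subzn_opp (ltnW ik)) (subzn_opp ik); apply: le_trans (normc_linN_le _ _) _.
by apply: le_trans (lerD (av _ _) (av _ _)) _; lra.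
Qed.

Lemma ae_scaling a (S : K -> Prop) : a != 0 -> (\forall x \ae mu, S x) ->
  \forall x \ae mu, S (a * x).
Proof.
move=> a0 [A [mA A0 SA]]; exists [set a^-1 * x | x in A]; split.
- by apply: measurable_scaling => //; rewrite invr_neq0.
- rewrite (haar_scaling _ mA); rewrite [X in (_ * X)%E]A0; exact: mule0.
- move=> x /= /SA Ax; exists (a * x) => //; by rewrite mulKf.
Qed.

Lemma Lnorm_scaling (r : \bar R) h (k : nat) : (0 < r)%E -> cmeasurable h ->
  (Ln r (fun x => h (p ^- k * x)%R) <= (Q k `^ (- rinv r))%:E * Ln r h)%E.
Proof.
move=> + mh; have p0 : p ^- k != 0.
  by rewrite invr_neq0// expf_neq0//; exact: prime_neq0.
have absp : abs (p ^- k) = Q k.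
  by rewrite absV absX abs_prime exprVn invrK.
case: r => [r| |//] r0.
  rewrite lte_fin in r0; rewrite !Lnorm_normcE rinv_EFin//.
  have mhr := @measurable_normc_powR h r setT mh.
  have := integral_scaling p0 mhr; rewrite absp => ->.
  have J0 : (0 <= \int[mu]_x (normc (h x) `^ r)%:E)%E.
    by apply: integral_ge0 => x _; rewrite lee_fin powR_ge0.
  have Q1 : (0 <= (Q k)^-1%:E)%E by rewrite lee_fin invr_ge0; exact: ltW (Q_gt0 k).
  rewrite (poweRM _ Q1 J0).
  by rewrite poweR_EFin -powR_inv1 ?(ltW (Q_gt0 k))// -powRrM mulN1r.
rewrite rinvy oppr0 powRr0 mul1e; apply/Lnormy_leP.
have : \forall x \ae mu, ((normc (h x))%:E <= Ln +oo%E h)%E by apply/Lnormy_leP.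
exact: ae_scaling.
Qed.

(** [dLnorm] is an infimum over representatives, so c is first divided out and each representative
    of G1 is treated alone. If there is none, the right-hand side is +oo since c > 0. *)
Lemma dLnorm_le_scale (r : \bar R) (G1 G2 : functional R K) (c : R) : 0 < c ->
  (forall h, represents h G1 ->
    exists2 h', represents h' G2 & (Ln r h' <= c%:E * Ln r h)%E) ->
  (dLnorm mu abs q r G2 <= c%:E * dLnorm mu abs q r G1)%E.
Proof.
move=> c0 H; rewrite -lee_pdivrMl//; apply: le_ereal_inf_tmp => _ [h rep <-].
rewrite lee_pdivrMl//; have [h' rep' /(le_trans _)] := H h rep; apply.
by apply: ereal_inf_lbound; exists h'.
Qed.

Lemma dLnorm_Delta_high (r : \bar R) F (j k : nat) : (0 < r)%E ->
  (dLnorm mu abs q r (Delta (j.+1 + k) (dilation k F)) <=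
    (Q k `^ (- rinv r))%:E * dLnorm mu abs q r (Delta j.+1 F))%E.
Proof.
move=> r0; apply: dLnorm_le_scale; first by rewrite powR_gt0.
move=> h rep; exists (fun x => h (p ^- k * x)).
  exact: Delta_dilation_high.
by apply: Lnorm_scaling => //; case: rep => -[].
Qed.

Lemma dLnorm_Delta_low (r : \bar R) : (0 < r)%E -> exists2 C : R, 0 < C &
  forall F (k i : nat), (i <= k)%N -> is_distribution abs q F ->
  (dLnorm mu abs q r (Delta i (dilation k F)) <=
    (Q k `^ (- rinv r) * (C * Q (k.+1 - i) `^ sigma_r r))%:E * dLnorm mu abs q r (Delta 0 F))%E.
Proof.
move=> r0; have [C C0 HC] := Lnorm_lowpart r0; exists C => // F k i ik dF.
have P0 : 0 < Q k `^ (- rinv r) by rewrite powR_gt0.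
apply: dLnorm_le_scale; first by rewrite !mulr_gt0 ?powR_gt0.
move=> h rep.
have rep' := Delta_dilation_low ik dF rep.
exists (fun x => lowpart k i h (p ^- k * x)); first exact: rep'.
have ml : cmeasurable (lowpart k i h).
  have ma m := cmeasurable_average m h.
  case: i {ik rep'} => [|j]; first exact: ma.
  by apply: cmeasurableD; [apply: cmeasurableM; [exact: cmeasurable_cst|exact: ma]|exact: ma].
apply: le_trans (Lnorm_scaling k r0 ml) _.
rewrite EFinM -muleA; apply: lee_wpmul2l; first by rewrite lee_fin ltW.
exact: HC rep.
Qed.

(** * Weighted frequency pieces and their summation *)

Variables (r : \bar R) (s : R).
Hypothesis hr : (0 < r)%E.
Hypothesis hs : sigma_r r < s.

Definition weighted_norm F (i : nat) : \bar R :=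
  ((q%:R `^ (s * i%:R))%:E * dLnorm mu abs q r (Delta i F))%E.

Lemma dLnorm_ge0 (G : functional R K) : (0 <= dLnorm mu abs q r G)%E.
Proof. by apply: le_ereal_inf_tmp => _ [h _ <-]; exact: Lnorm_ge0. Qed.

Lemma weighted_norm_ge0 F (i : nat) : (0 <= weighted_norm F i)%E.
Proof. by apply: mule_ge0; [rewrite lee_fin powR_ge0|exact: dLnorm_ge0]. Qed.

Lemma powR_exprn (n : nat) (c : R) : Q n `^ c = q%:R `^ (n%:R * c).
Proof. by rewrite powRrM powR_mulrn// ltW. Qed.

(** Truncated subtraction lets one formula cover both ranges: every i <= k is compared with piece 0,
    every i > k with the shifted piece. *)
Lemma weighted_norm_dilation : exists2 M : R, 0 < M &
  forall F (k i : nat), is_distribution abs q F ->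
  (weighted_norm (dilation k F) i <=
    (M * q%:R `^ (k%:R * (s - rinv r)))%:E * weighted_norm F (i - k)%N)%E.
Proof.
have [C C0 HC] := dLnorm_Delta_low hr.
have QD (x y : R) : q%:R `^ x * q%:R `^ y = q%:R `^ (x + y).
  by rewrite powRD//; apply/implyP => _; exact: lt0r_neq0.
(* The 1 serves the high frequencies. In the low ones (k + 1 - i) sigma_r exceeds (k - i) sigma_r by
   sigma_r, which costs the factor q^(sigma_r). *)
pose M := Num.max 1 (C * q%:R `^ sigma_r r); exists M; first by rewrite lt_max ltr01.
move=> F k i dF; have [ik|ki] := leqP i k.
  rewrite /weighted_norm (eqP (_ : (i - k)%N == 0%N)) ?subn_eq0// mulr0 powRr0 mul1e.
  apply: (@le_trans _ _ ((q%:R `^ (s * i%:R))%:E *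
      ((Q k `^ (- rinv r) * (C * Q (k.+1 - i) `^ sigma_r r))%:E *
        dLnorm mu abs q r (Delta 0 F)))%E).
    by apply: lee_wpmul2l; [rewrite lee_fin powR_ge0|exact: HC].
  rewrite muleA -EFinM; apply: lee_wpmul2r; first exact: dLnorm_ge0.
  rewrite lee_fin; apply: (@le_trans _ _ (C * q%:R `^ sigma_r r * q%:R `^ (k%:R * (s - rinv r)))).
    rewrite !powR_exprn -[leRHS]mulrA QD.
    rewrite (_ : q%:R `^ (s * i%:R) * _ =
        C * q%:R `^ (s * i%:R + (k%:R * - rinv r + (k.+1 - i)%:R * sigma_r r))); last first.
      by rewrite -!QD; ring.
    rewrite ler_pM2l// ler_powR ?(ltW residue_card_gt1)//.
    rewrite natrB ?leqW// -natr1.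
    have ik' : 0 <= k%:R - i%:R :> R by rewrite subr_ge0 ler_nat.
    (* This product bounds (k - i) sigma_r by (k - i) s, which together with s i makes s k. *)
    have := mulr_ge0 ik' (ltW (_ : 0 < s - sigma_r r)); rewrite subr_gt0 => /(_ hs).
    nra.
  by rewrite ler_wpM2r ?powR_ge0// le_max lexx orbT.
have -> : i = ((i - k).-1.+1 + k)%N by lia.
set j := (i - k).-1; rewrite addnK /weighted_norm.
apply: (@le_trans _ _ ((q%:R `^ (s * (j.+1 + k)%:R))%:E *
    ((Q k `^ (- rinv r))%:E * dLnorm mu abs q r (Delta j.+1 F)))%E).
  apply: lee_wpmul2l; first by rewrite lee_fin powR_ge0.
  exact: dLnorm_Delta_high.
rewrite !muleA; apply: lee_wpmul2r; first exact: dLnorm_ge0.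
rewrite -!EFinM lee_fin powR_exprn -mulrA !QD natrD.
have -> : s * (j.+1%:R + k%:R) + k%:R * - rinv r = k%:R * (s - rinv r) + s * j.+1%:R by ring.
by rewrite ler_peMl ?powR_ge0// le_max lexx.
Qed.

End LocalField.

Theorem theorem1p1 (R : realType) (K : topologicalFieldType)
  (mu : {measure set (borel K) -> \bar R}) (abs : K -> R) (q : nat) (p : K)
  (chi : K -> R[i])
  (hK : local_field K)
  (hmu : haar_measure mu)
  (habs : natural_abs mu abs)
  (hnormalized : mu (integers abs) = 1%E)
  (hq : residue_card abs q)
  (hp : prime_element abs p)
  (hchi : basic_character abs q chi)
  (r t : \bar R) (s : R)
  (hr : (0 < r)%E) (ht : (0 < t)%E) (hs : sigma_r r < s) :
  exists c : R, forall (k : nat) (f : functional R K), (0 < k)%N ->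
    besov mu abs q chi s r t f ->
    (besov_norm mu abs q chi s r t (dilation q p k f)
       <= (c * k%:R `^ rinv t * q%:R `^ (k%:R * (s - rinv r)))%:E
          * besov_norm mu abs q chi s r t f)%E.
Proof.
have [M M0 HM] := weighted_norm_dilation hK hmu habs hnormalized hq hp hchi hr hs.
(* The 2 absorbs k + 1 <= 2 k, valid as k >= 1; for t = +oo its power is 1. *)
exists (2 `^ rinv t * M) => k f k0 [df _].
pose A := q%:R `^ (k%:R * (s - rinv r)) : R.
have A0 : 0 <= A by exact: powR_ge0.
have MA0 : 0 <= M * A by rewrite mulr_ge0// ltW.
pose w := weighted_norm mu abs q chi r s.
have w0 F i : (0 <= w F i)%E by exact: weighted_norm_ge0.
rewrite -/A; case: t ht => [t| |//] t0; last first.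
  rewrite rinvy !powRr0 mul1r mulr1 /=.
  apply: ge_ereal_sup => _ [i _ <-].
  apply: le_trans (HM f k i df) _; apply: lee_wpmul2l; first by rewrite lee_fin.
  by apply: ereal_sup_ubound; exists (i - k)%N.
rewrite lte_fin in t0; rewrite rinv_EFin// /besov_norm.
have ti0 : 0 <= t^-1 by rewrite invr_ge0 ltW.
(* Moving the weight inside the power t makes the Besov norm the l^t norm of the sequence [w F]. *)
have e F : (\sum_(0 <= j <oo) ((q%:R `^ (s * j%:R * t))%:E *
    poweR (dLnorm mu abs q r (Delta mu abs q chi j F)) t) = \sum_(0 <= j <oo) (w F j) `^ t)%E.
  apply: eq_eseriesr => j _; rewrite /w /weighted_norm.
  rewrite poweRM ?lee_fin ?powR_ge0//; last exact: dLnorm_ge0.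
  by rewrite poweR_EFin -powRrM.
rewrite !e; pose S := (\sum_(0 <= j <oo) (w f j) `^ t)%E; rewrite -/S.
have S0 : (0 <= S)%E by apply: nneseries_ge0 => j _ _; exact: poweR_ge0.
have le1 : (\sum_(0 <= j <oo) (w (dilation q p k f) j) `^ t <=
    ((M * A) `^ t * (2 * k%:R))%:E * S)%E.
  apply: (@le_trans _ _ (\sum_(0 <= j <oo) (((M * A) `^ t)%:E * (w f (j - k)%N) `^ t))%E).
    apply: lee_nneseries => [j _ _|j _]; first exact: poweR_ge0.
    rewrite -poweR_EFin -poweRM//; apply: poweR_le; [exact: ltW|exact: w0|exact: HM].
  rewrite nneseriesZl; last by move=> j _; exact: poweR_ge0.
  rewrite EFinM -muleA; apply: lee_wpmul2l; first by rewrite lee_fin powR_ge0.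
  apply: (@le_trans _ _ (k.+1%:R%:E * S)%E).
    by apply: (nneseries_delay_le k (u := fun j => ((w f j) `^ t)%E)) => j; exact: poweR_ge0.
  apply: lee_wpmul2r => //; rewrite lee_fin -natrM ler_nat; lia.
apply: le_trans (poweR_le ti0 _ le1) _.
  by apply: nneseries_ge0 => j _ _; exact: poweR_ge0.
rewrite poweRM ?lee_fin ?mulr_ge0 ?powR_ge0//; apply: lee_wpmul2r; first exact: poweR_ge0.
rewrite poweR_EFin lee_fin powRM ?mulr_ge0 ?powR_ge0// -(powRrM (M * A)).
rewrite divff ?lt0r_neq0// powRr1// powRM//.
by rewrite le_eqVlt; apply/orP; left; apply/eqP; ring.
Qed.
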